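(* Let $a$ and $b$ be strictly accretive elements in a unital operator algebra. Then $$G=a^{1/2}\,(a^{-1/2}\,b\,a^{-1/2})^{1/2}\,a^{1/2}$$ is strictly accretive too. Moreover $G$ is the unique strictly accretive solution $x$ to the equation $x\,a^{-1}\,x=b$, and $$G=b^{1/2}\,(b^{-1/2}\,a\,b^{-1/2})^{1/2}\,b^{1/2}.$$
   Context: A unital operator algebra is a closed subalgebra $A$ of $B(H)$, $H$ a complex Hilbert space, containing the identity. The numerical range of $x\in A$ is $W(x)=\{\varphi(x):\varphi\in A^*,\ \|\varphi\|=\varphi(1)=1\}$, a compact convex set, equal to the closure of $\{\langle x\zeta,\zeta\rangle:\|\zeta\|=1\}$. An element $x$ is strictly accretive if $W(x)$ is contained in the open right half plane $\mathbb{H}$ (such $x$ is invertible). If $x$ has spectrum disjoint from $(-\infty,0]$, then $x^{1/2}$ is the principal square root: the unique square root of $x$ with spectrum in $\mathbb{H}$; and $x^{-1/2}=(x^{1/2})^{-1}$. It is part of the claim that $a^{-1/2}ba^{-1/2}$ and $b^{-1/2}ab^{-1/2}$ have spectrum disjoint from $(-\infty,0]$, so that the principal square roots are defined. *)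

(* Defs.v *)
From HB Require Import structures.
From mathcomp Require Import all_boot all_order all_algebra.
From mathcomp Require Import all_classical all_reals all_analysis.
From mathcomp Require Export complex.

Set Implicit Arguments.
Unset Strict Implicit.
Unset Printing Implicit Defensive.

Import Order.TTheory GRing.Theory Num.Theory.
Import numFieldNormedType.Exports.

Local Open Scope classical_set_scope.
Local Open Scope ring_scope.

Section Operators.
Context {R : realType} {H : completeNormedModType R[i]}.

(* The library norm of a normed module over R[i] takes its values in R[i];
   rnorm is the same norm, seen as an element of R. *)
Definition rnorm (u : H) : R := complex.Re `|u|.

(* Membership in B(H). *)
Definition bounded_operator (f : H -> H) : Prop :=
  linear f /\ exists M : R, forall u, rnorm (f u) <= M * rnorm u.

Definition opnorm (f : H -> H) : R :=
  sup [set rnorm (f u) | u in [set u | rnorm u <= 1]].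

(* Sums and scalar multiples of operators are the pointwise ones of H -> H;
   the product is composition. *)
Record unital_operator_algebra (A : set (H -> H)) : Prop :=
  UnitalOperatorAlgebra {
    uoa_bounded : forall f, A f -> bounded_operator f;
    uoa_one : A idfun;
    uoa_add : forall f g, A f -> A g -> A (f + g);
    uoa_scale : forall (c : R[i]) f, A f -> A (c *: f);
    uoa_mul : forall f g, A f -> A g -> A (f \o g);
    uoa_closed : forall f, bounded_operator f ->
      (forall e : R, 0 < e -> exists2 g, A g & opnorm (f - g) < e) -> A f }.

Section Algebra.
Variable A : set (H -> H).

(* A functional on A is represented by a function on all of H -> H, of which
   only the values on A matter. *)
Definition dual_functional (phi : (H -> H) -> R[i]) : Prop :=
  (forall (c : R[i]) f g, A f -> A g -> phi (c *: f + g) = c * phi f + phi g)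
  /\ exists M : R, forall f, A f -> complex.Re `|phi f| <= M * opnorm f.

Definition dual_norm (phi : (H -> H) -> R[i]) : R :=
  sup [set complex.Re `|phi f| | f in [set f | A f /\ opnorm f <= 1]].

Definition states : set ((H -> H) -> R[i]) :=
  [set phi | [/\ dual_functional phi, dual_norm phi = 1 & phi idfun = 1]].

Definition numerical_range (x : H -> H) : set R[i] :=
  [set phi x | phi in states].

Definition right_half_plane : set R[i] := [set z | 0 < complex.Re z].

Definition nonpos_reals : set R[i] :=
  [set z | complex.Re z <= 0 /\ complex.Im z = 0].

Definition strictly_accretive (x : H -> H) : Prop :=
  A x /\ numerical_range x `<=` right_half_plane.

Definition is_inverse (x y : H -> H) : Prop :=
  [/\ A y, x \o y = idfun & y \o x = idfun].

Definition spectrum (x : H -> H) : set R[i] :=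
  [set l | ~ exists y, is_inverse (l *: idfun - x) y].

Definition is_principal_sqrt (x r : H -> H) : Prop :=
  [/\ A r, r \o r = x & spectrum r `<=` right_half_plane].

(* x^{-1}, with junk value 0 if x is not invertible in A. *)
Definition opinv (x : H -> H) : H -> H := xget 0 [set y | is_inverse x y].

(* x^{1/2}: the unique square root of x in A with spectrum in the open right
   half plane, with junk value 0 if there is none or more than one. *)
Definition opsqrt (x : H -> H) : H -> H :=
  xget 0 [set r | unique (is_principal_sqrt x) r].

(* a^{-1/2} b a^{-1/2} *)
Definition sandwich (a b : H -> H) : H -> H :=
  opinv (opsqrt a) \o b \o opinv (opsqrt a).

(* a^{1/2} (a^{-1/2} b a^{-1/2})^{1/2} a^{1/2} *)
Definition gmean (a b : H -> H) : H -> H :=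
  opsqrt a \o opsqrt (sandwich a b) \o opsqrt a.

End Algebra.
End Operators.

(* Main.v *)
(** Write a # b for the limit of the arithmetic-harmonic iteration
    a' = (a + b) / 2, b' = 2 (a^-1 + b^-1)^-1. Lower bounds Re >= d pass to
    arithmetic and to harmonic means, so all iterates, and all their convex
    combinations, have uniformly bounded inverses. For z on the unit circle let
    p_n(z) be the inverse of (1 + Re z)/2 a_n^-1 + (1 - Re z)/2 b_n^-1; it
    interpolates between a_n = p_n(1) and b_n = p_n(-1), and
    p_(n+1)(z^2) = (p_n(z) + p_n(-z)) / 2. Since square roots contract the
    circle, the Lipschitz constants of the p_n decay geometrically, so
    a_n - b_n -> 0 and the iteration converges to some G with Re G >= d.

    An identity a v b = w = b v a is preserved by the iteration, hence passes to
    G v G = w. With v = a^-1 this gives G a^-1 G = b; with v = x^-1, for another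
    accretive solution x, it gives G x^-1 G = x, so (x^-1 G)^2 = 1 and x = G.
    The spectrum of a^-1 G lies in the right half plane because the powers
    q^(2^n) = (a_n + G)^-1 (a_n - G) of its Cayley transform tend to 0; hence
    a^(-1/2) G a^(-1/2) is the principal square root of a^(-1/2) b a^(-1/2).
    Exchanging a and b gives the second formula by uniqueness.

    Principal square roots are unique: if r^2 = r'^2 and q, q' are the Cayley
    transforms, then r - r' = q^m (r - r') q'^m for all m, and q^m, q'^m -> 0.
    That a spectrum inside the open unit disc forces q^(2^n) to be eventually
    small is proved by the same doubling argument, applied to
    z |-> (1 - z q^(2^n))^-1. *)

Require Import Defs.
From HB Require Import structures.
From mathcomp Require Import all_boot all_order all_algebra.
From mathcomp Require Import all_classical all_reals all_analysis.
From mathcomp Require Import complex.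
From mathcomp Require Import ring lra.

Set Implicit Arguments.
Unset Strict Implicit.
Unset Printing Implicit Defensive.

Import Order.TTheory GRing.Theory Num.Theory.
Import numFieldNormedType.Exports.
Import Normc.

Local Open Scope classical_set_scope.
Local Open Scope ring_scope.

(** * Banach algebras *)

Section Geometric.
Context {R : realType}.
Implicit Types rho e a K : R.

Lemma expr_small rho e : 0 <= rho < 1 -> 0 < e -> exists n, rho ^+ n < e.
Proof.
move=> /andP[r0 r1] e0; have nr : `|rho| < 1 by rewrite ger0_norm.
have /cvgrPdist_lt/(_ e e0)[n _ /(_ n (leqnn n))] := cvg_expr nr.
by rewrite /= sub0r normrN normrX ger0_norm //; exists n.
Qed.

Lemma geometric_le0 rho a K :
  0 <= rho < 1 -> (forall n, a <= K * rho ^+ n) -> a <= 0.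
Proof.
move=> hr h; have /andP[r0 r1] := hr.
have K1 : 0 < `|K| + 1 by rewrite ltr_pwDr.
rewrite leNgt; apply/negP => a0.
have [n hn] := expr_small hr (divr_gt0 a0 K1).
have := h n; rewrite leNgt => /negP; apply.
rewrite ltr_pdivlMr // in hn; apply: le_lt_trans hn.
by rewrite mulrC ler_wpM2l ?exprn_ge0 // (le_trans (ler_norm K)) // lerDl.
Qed.

End Geometric.

Lemma one_sub_sqr (A : pzRingType) (x : A) : 1 - x ^+ 2 = (1 - x) * (1 + x).
Proof. by rewrite -opprB subr_sqr_1 -mulNr opprB [x + 1]addrC. Qed.

Lemma invr_sub (A : unitRingType) (x y : A) :
  x \is a GRing.unit -> y \is a GRing.unit ->
  x^-1 - y^-1 = x^-1 * (y - x) * y^-1.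
Proof. by move=> ux uy; rewrite mulrBr mulrBl mulrK // mulVr // mul1r. Qed.

Lemma invr_add (A : unitRingType) (x y : A) :
  x \is a GRing.unit -> y \is a GRing.unit ->
  x^-1 + y^-1 = x^-1 * (y + x) * y^-1.
Proof. by move=> ux uy; rewrite mulrDr mulrDl mulrK // mulVr // mul1r. Qed.

(** * Complex modulus and square roots on the unit circle *)

Section Modulus.
Local Open Scope complex_scope.
Context {R : realType}.
Implicit Types z w : R[i].

Lemma normr_normc z : `|z| = (normc z)%:C.
Proof. by case: z. Qed.

Lemma normc_ge0 z : 0 <= normc z.
Proof. by rewrite -lecR -normr_normc; exact: normr_ge0. Qed.

Lemma normcN z : normc (- z) = normc z.
Proof. by apply: complexI; rewrite -!normr_normc normrN. Qed.

Lemma normcX z n : normc (z ^+ n) = normc z ^+ n.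
Proof. by apply: complexI; rewrite -!normr_normc normrX normr_normc rmorphXn. Qed.

Lemma normc_sqrE z : normc z ^+ 2 = complex.Re z ^+ 2 + complex.Im z ^+ 2.
Proof. by case: z => a b /=; rewrite sqr_sqrtr // addr_ge0 ?sqr_ge0. Qed.

Lemma normc_realC (t : R) : normc t%:C = `|t|.
Proof. by rewrite /= expr0n addr0 sqrtr_sqr. Qed.

Lemma normc_nat n : normc (n%:R : R[i]) = n%:R.
Proof. by rewrite -(rmorph_nat (real_complex R)) normc_realC ger0_norm. Qed.

Lemma normc_half : normc (2^-1 : R[i]) = 2^-1.
Proof. by rewrite normcV normc_nat. Qed.

Lemma normc_parallelogram z w :
  normc (z + w) ^+ 2 + normc (z - w) ^+ 2 = 2 * normc z ^+ 2 + 2 * normc w ^+ 2.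
Proof. by rewrite !normc_sqrE; case: z => a b; case: w => c d /=; ring. Qed.

Lemma normc_leD z w : normc (z + w) <= normc z + normc w.
Proof. by rewrite -lecR rmorphD /= -!normr_normc ler_normD. Qed.

Lemma Re_le_normc z : `|complex.Re z| <= normc z.
Proof. by rewrite -lecR -normr_normc; exact: normc_ge_Re. Qed.

Lemma Im_le_normc z : `|complex.Im z| <= normc z.
Proof.
have := Re_le_normc ('i%C * z); rewrite normcM /= expr0n expr1n add0r sqrtr1.
by case: z => a b /=; rewrite mul1r mul0r sub0r mul1r normrN.
Qed.

Lemma complexB_split (a b c d : R) :
  (a +i* b)%C - (c +i* d)%C = (a - c)%:C + 'i%C * (b - d)%:C.
Proof. by apply/eqP; rewrite eq_complex /=; apply/andP; split; apply/eqP; ring. Qed.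

(** The real part is [(1 - |z|^2) / |1 + z|^2]. *)
Lemma Re_cayley_ge0 z : normc z <= 1 -> z != - 1 ->
  0 <= complex.Re ((1 - z) / (1 + z)).
Proof.
move=> z1 z2; have : normc z ^+ 2 <= 1 by rewrite expr_le1 ?normc_ge0.
rewrite normc_sqrE; case: z z1 z2 => a b /= _ z2 h.
set k := (_ + _)^-1; have k0 : 0 <= k by rewrite invr_ge0 addr_ge0 ?sqr_ge0.
rewrite [leRHS](_ : _ = k * (1 - (a ^+ 2 + b ^+ 2))); last by ring.
by rewrite mulr_ge0 // subr_ge0.
Qed.

Lemma expr_root n z : (0 < n)%N -> exists w, w ^+ n = z.
Proof. by move=> n0; exists (n.-root z); rewrite rootCK. Qed.

Lemma unit_circle_sqrt z : normc z = 1 -> exists2 w, normc w = 1 & w ^+ 2 = z.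
Proof.
move=> z1; have [w wz] := @expr_root 2 z isT; exists w => //.
apply/eqP; rewrite -(@pexpr_eq1 _ _ 2) ?normc_ge0 //.
by rewrite -normcX wz z1.
Qed.

(* On the unit circle squaring expands distances between points at angle at
   most a right angle, by a factor at least sqrt 2 >= 4/3. *)
Lemma unit_circle_sqrt2 z w : normc z = 1 -> normc w = 1 ->
  exists z' w', [/\ normc z' = 1, normc w' = 1, z' ^+ 2 = z, w' ^+ 2 = w &
    normc (z' - w') <= 3 / 4 * normc (z - w)].
Proof.
move=> z1 w1; have [z' z'1 zz] := unit_circle_sqrt z1.
have [w0 w01 ww] := unit_circle_sqrt w1.
(* By the parallelogram law [|z' + w0|^2 + |z' - w0|^2 = 4], so one of the two signs of [w0]
   works. *)
have [w' [w'1 w'w h]] : exists w', [/\ normc w' = 1, w' ^+ 2 = w &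
    2 <= normc (z' + w') ^+ 2].
  have := normc_parallelogram z' w0; rewrite z'1 w01 expr1n => par.
  have [h|h] := lerP 2 (normc (z' + w0) ^+ 2); first by exists w0.
  exists (- w0); split; [by rewrite normcN|by rewrite sqrrN|].
  by move: par h; lra.
exists z', w'; split => //.
rewrite -zz -w'w subr_sqr normcM.
have h2 : 4 / 3 <= normc (z' + w').
  rewrite -(@ler_pXn2r _ 2) ?nnegrE ?normc_ge0 //.
  by move: h; lra.
have := ler_wpM2l (normc_ge0 (z' - w')) h2; lra.
Qed.

End Modulus.

(** * Resolvents, powers and Cayley transforms in a Banach algebra *)

Section BanachAlgebra.
Local Open Scope complex_scope.
Context {R : realType} {B : unitAlgType R[i]}.

Lemma scaler_half_double (x : B) : (2^-1 : R[i]) *: (x + x) = x.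
Proof.
by rewrite -mulr2n -[X in _ *: X]scaler_nat scalerA mulVf ?scale1r.
Qed.

(** Completeness is stated for geometrically decaying increments and includes the rate, so limits in
    [B] are handled by explicit estimates, without a topology on [B]. *)
Record banach_norm (N : B -> R) : Prop := BanachNorm {
  bn_triangle : forall x y, N (x + y) <= N x + N y;
  bn_mul : forall x y, N (x * y) <= N x * N y;
  bn_scale : forall k x, N (k *: x) <= normc k * N x;
  bn_eq0 : forall x, N x = 0 -> x = 0;
  bn_one : N 1 <= 1;
  bn_complete : forall (u : nat -> B) (M rho : R), 0 <= rho < 1 ->
    (forall n, N (u n.+1 - u n) <= M * rho ^+ n) ->
    exists l, forall n, N (u n - l) <= M / (1 - rho) * rho ^+ n }.

Context {N : B -> R} (bN : banach_norm N).
Implicit Types x y q r : B.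

Lemma bn0 : N 0 = 0.
Proof.
have h := bn_scale bN 0 0; rewrite scale0r normc0 mul0r in h.
have h2 := bn_triangle bN 0 0; rewrite addr0 in h2.
by apply/eqP; rewrite eq_le h /=; move: h2; lra.
Qed.

Lemma bn_opp x : N (- x) = N x.
Proof.
have le y : N (- y) <= N y.
  by rewrite -scaleN1r (le_trans (bn_scale bN _ _)) // normcN normc1 mul1r.
by apply/eqP; rewrite eq_le le -{1}[x]opprK le.
Qed.

Lemma bn_ge0 x : 0 <= N x.
Proof.
have := bn_triangle bN x (- x); rewrite subrr bn0 bn_opp; lra.
Qed.

Lemma bn_sub x y : N (x - y) <= N x + N y.
Proof. by rewrite -(bn_opp y) (bn_triangle bN). Qed.

Lemma bn_expr x n : N (x ^+ n) <= N x ^+ n.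
Proof.
elim: n => [|n IH]; first by rewrite !expr0 bn_one.
by rewrite !exprS (le_trans (bn_mul bN _ _)) // ler_wpM2l ?bn_ge0.
Qed.

Lemma bn_mul_le x y c d : N x <= c -> N y <= d -> N (x * y) <= c * d.
Proof.
by move=> hx hy; rewrite (le_trans (bn_mul bN _ _)) // ler_pM ?bn_ge0.
Qed.

Lemma bn_eq x y : N (x - y) <= 0 -> x = y.
Proof.
move=> h; apply/eqP; rewrite -subr_eq0; apply/eqP/(bn_eq0 bN)/eqP.
by rewrite eq_le h bn_ge0.
Qed.

Lemma geometric_eq x y K rho : 0 <= rho < 1 ->
  (forall n, N (x - y) <= K * rho ^+ n) -> x = y.
Proof. by move=> hr h; apply: bn_eq; apply: geometric_le0 hr h. Qed.

(** The partial sums [u n] of the geometric series converge, and their products with [1 - x] on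
    either side are [1 - x ^+ n]. *)
Lemma neumann x : N x < 1 -> 1 - x \is a GRing.unit.
Proof.
move=> x1; have hr : 0 <= N x < 1 by rewrite bn_ge0.
pose u n := \sum_(i < n) x ^+ i.
have hu n : N (u n.+1 - u n) <= 1 * N x ^+ n.
  by rewrite /u big_ord_recr /= [_ + x ^+ n]addrC addrK mul1r bn_expr.
have [l hl] := bn_complete bN hr hu.
have ul n : (1 - x) * u n = 1 - x ^+ n.
  by rewrite -(opprB x 1) mulNr -subrX1 opprB.
have ur n : u n * (1 - x) = 1 - x ^+ n.
  rewrite -ul; apply/esym/commr_sum => i _; apply/commrX/commr_sym.
  by apply: commrB; [exact: commr1|exact: commr_refl].
apply/unitrP; exists l; split; apply/esym.
- apply: (geometric_eq (K := N (1 - x) / (1 - N x) + 1) hr) => n.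
  have -> : 1 - l * (1 - x) = (u n - l) * (1 - x) + x ^+ n.
    by rewrite mulrBl ur addrAC subrK.
  rewrite (le_trans (bn_triangle bN _ _)) // [leRHS]mulrDl mul1r lerD ?bn_expr //.
  rewrite (le_trans (bn_mul bN _ _)) //.
  have := ler_wpM2r (bn_ge0 (1 - x)) (hl n); move/le_trans; apply.
  by lra.
- apply: (geometric_eq (K := N (1 - x) / (1 - N x) + 1) hr) => n.
  have -> : 1 - (1 - x) * l = (1 - x) * (u n - l) + x ^+ n.
    by rewrite mulrBr ul addrAC subrK.
  rewrite (le_trans (bn_triangle bN _ _)) // [leRHS]mulrDl mul1r lerD ?bn_expr //.
  rewrite (le_trans (bn_mul bN _ _)) //.
  have := ler_wpM2l (bn_ge0 (1 - x)) (hl n); move/le_trans; apply.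
  by lra.
Qed.

Lemma neumann_inv x : N x < 1 -> N (1 - x)^-1 <= (1 - N x)^-1.
Proof.
move=> x1; have ux := neumann x1.
have e : (1 - x)^-1 = 1 + x * (1 - x)^-1.
  by rewrite -[X in _ = X + _](mulrV ux) -mulrDl subrK mul1r.
have x1' : 0 < 1 - N x by rewrite subr_gt0.
rewrite -[leRHS]mul1r ler_pdivlMr //.
have := bn_triangle bN 1 (x * (1 - x)^-1); rewrite -e.
have := bn_mul bN x (1 - x)^-1; have := bn_one bN.
by move: (N x) (N (1 - x)^-1) (N (x / _)) => a c d *; nra.
Qed.

(** [1 - x] divides [1 - x ^+ (2 ^ n)] with a commuting quotient, and commuting factors of a unit
    are units. *)
Lemma unit_sub_pow2 x n : (1 - x ^+ (2 ^ n) \is a GRing.unit) ->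
  1 - x \is a GRing.unit.
Proof.
have := subrX1 x (2 ^ n); set S := \sum_(i < _) _ => e.
have {}e : 1 - x ^+ (2 ^ n) = (1 - x) * S.
  by rewrite -opprB e -mulNr opprB.
rewrite e unitrM_comm; first by case/andP.
apply: commr_sum => i _; apply/commrX/commr_sym.
by apply: commrB; [exact: commr1|exact: commr_refl].
Qed.

(** If [w ^+ 2 = z], then [1 - z x^2 = (1 - w x) (1 + w x)], and [w], [- w] stay in the closed
    disc. *)
Lemma unit_pow2 x n :
  (forall z, normc z <= 1 -> 1 - z *: x \is a GRing.unit) ->
  forall z, normc z <= 1 -> 1 - z *: x ^+ (2 ^ n) \is a GRing.unit.
Proof.
elim: n x => [|n IH] x h; first by rewrite expr1.
rewrite expnS exprM; apply: IH => z z1.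
have [w wz] := @expr_root _ 2 z isT.
have w1 : normc w <= 1.
  by rewrite -(@expr_le1 _ 2) ?normc_ge0 // -normcX wz.
have -> : 1 - z *: x ^+ 2 = (1 - w *: x) * (1 - (- w) *: x).
  by rewrite scaleNr opprK -wz -exprZn one_sub_sqr.
rewrite unitrM_comm; first by rewrite !h ?normcN.
rewrite scaleNr opprK; apply: commrD; first exact: commr1.
by apply/commr_sym/commrB; first exact: commr1.
Qed.

(** A difference at level [n.+1] is the mean of two differences at level [n], taken between square
    roots that are closer by a factor 3/4. Each level therefore multiplies the Lipschitz constant by
    3/4; the points 1 and -1 are at distance 2. *)
Lemma circle_doubling (f : nat -> R[i] -> B) (L : R) : 0 <= L ->
  (forall n z, normc z = 1 -> f n.+1 (z ^+ 2) = 2^-1 *: (f n z + f n (- z))) ->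
  (forall z w, normc z = 1 -> normc w = 1 ->
     N (f 0 z - f 0 w) <= L * normc (z - w)) ->
  forall n, N (f n 1 - f n (- 1)) <= 2 * L * (3 / 4) ^+ n.
Proof.
move=> L0 fS f0.
have step n z w : normc z = 1 -> normc w = 1 ->
    N (f n z - f n w) <= L * (3 / 4) ^+ n * normc (z - w).
  elim: n z w => [|n IH] z w z1 w1; first by rewrite expr0 mulr1 f0.
  have [z' [w' [z'1 w'1 <- <- h]]] := unit_circle_sqrt2 z1 w1.
  rewrite !fS // -scalerBr opprD addrACA (le_trans (bn_scale bN _ _)) //.
  rewrite normc_half.
  rewrite -ler_pdivlMl ?invr_gt0 // invrK (le_trans (bn_triangle bN _ _)) //.
  have h1 := IH _ _ z'1 w'1.
  have := IH (- z') (- w'); rewrite !normcN -opprD normcN => /(_ z'1 w'1) h2.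
  apply: le_trans (lerD h1 h2) _.
  have c0 : 0 <= L * (3 / 4) ^+ n by rewrite mulr_ge0 ?exprn_ge0 // divr_ge0.
  by rewrite exprSr; have := ler_wpM2l c0 h; lra.
move=> n; apply: le_trans (step n 1 (- 1) _ _) _; rewrite ?normcN ?normc1 //.
rewrite opprK -[1 + 1]/(2%:R) normc_nat.
by rewrite [leLHS]mulrC mulrA.
Qed.

(** A Neumann perturbation bounds the resolvent near each point; compactness of a square containing
    the disc makes the bound uniform. *)
Lemma resolvent_bound q :
  (forall z, normc z <= 1 -> 1 - z *: q \is a GRing.unit) ->
  exists C, forall z, normc z <= 1 -> N (1 - z *: q)^-1 <= C.
Proof.
move=> hq.
have loc z0 : exists2 d : R, 0 < d & exists C, forall z, normc (z - z0) < d ->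
    normc z <= 1 -> N (1 - z *: q)^-1 <= C.
  have [z01|z01] := lerP (normc z0) 1; last first.
    exists (normc z0 - 1); first by rewrite subr_gt0.
    exists 0 => z h1 h2; exfalso.
    have := normc_leD (z0 - z) z; rewrite subrK -opprB normcN.
    by move: h1 h2; lra.
  have u0 := hq _ z01; set I := (1 - z0 *: q)^-1.
  pose k := N (I * q); have k0 : 0 <= k by exact: bn_ge0.
  (* This radius makes the perturbation at most 1/2 in norm, so its Neumann inverse has norm at most
     2. *)
  exists (2 * (k + 1))^-1; first by rewrite invr_gt0; lra.
  exists (N I * 2) => z hz z1.
  have hv : N ((z - z0) *: (I * q)) <= 2^-1.
    rewrite (le_trans (bn_scale bN _ _)) // -/k.
    have := ler_wpM2r k0 (ltW hz); move/le_trans; apply.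
    by rewrite ler_pdivrMl; lra.
  have e : 1 - z *: q = (1 - z0 *: q) * (1 - (z - z0) *: (I * q)).
    rewrite mulrBr mulr1 -scalerAr mulrA mulrV // mul1r scalerBl opprB.
    by rewrite addrC addrA subrK addrC.
  have uv : 1 - (z - z0) *: (I * q) \is a GRing.unit by apply: neumann; lra.
  rewrite e invrM // mulrC; apply: bn_mul_le => //.
  apply: le_trans (neumann_inv _) _; first by lra.
  by rewrite -[leRHS]invrK lef_pV2 ?posrE; lra.
have : compact (`[(-1 : R), 1]%classic `*` `[(-1 : R), 1]%classic).
  by apply: compact_setX; exact: segment_compact.
(* In this form of compactness the parameter is the bound [C], tending to infinity. *)
move=> /compact_near_coveringP/(_ _ (+oo : set_system R)
  (fun C p => normc (p.1 +i* p.2)%C <= 1 -> N (1 - (p.1 +i* p.2)%C *: q)^-1 <= C)).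
case.
  move=> [x y] _ /=; have [d d0 [C hC]] := loc (x +i* y)%C.
  exists (ball (x, y) (d / 2), [set i | C < i]).
    split => /=; last by exists C; split; rewrite ?num_real.
    by apply: nbhsx_ballx; rewrite divr_gt0.
  move=> [[x' y'] i] [[/= hx hy] hi] z1; apply: le_trans (ltW hi).
  apply: hC => //; rewrite complexB_split (le_lt_trans (normc_leD _ _)) //.
  rewrite normcM !normc_realC /= expr0n expr1n add0r sqrtr1 mul1r.
  by move: hx hy; rewrite /ball /= !(distrC x) !(distrC y); lra.
move=> C [_ hC]; exists (C + 1) => -[x y] z1.
apply: (hC (C + 1) _ (x, y)) => //=; first by rewrite ltrDl.
have := Re_le_normc (x +i* y)%C; have := Im_le_normc (x +i* y)%C => /= hy hx.
by rewrite !in_itv /= -!ler_norml !(le_trans _ z1).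
Qed.

(** Partial fractions: this is the doubling relation required by [circle_doubling]. *)
Lemma inv_one_sub_sqr x : 1 - x \is a GRing.unit -> 1 + x \is a GRing.unit ->
  (1 - x ^+ 2)^-1 = 2^-1 *: ((1 - x)^-1 + (1 + x)^-1).
Proof.
move=> u1 u2; rewrite [X in _ *: X]addrC invr_add // addrACA addNr addr0.
by rewrite one_sub_sqr invrM // mulrDr mulr1 mulrDl scaler_half_double.
Qed.

(** If [M = N (q ^+ (2 ^ n))] were at least 1, rescaling [q] by a root [t] of [1 / M] would give
    [y = x ^+ (2 ^ n)] of norm 1. Doubling brings [(1 - y)^-1] and [(1 + y)^-1] close together,
    which forces [y] to be small. *)
Lemma spectral_radius_lt1 q :
  (forall z, normc z <= 1 -> 1 - z *: q \is a GRing.unit) ->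
  exists n, N (q ^+ (2 ^ n)) < 1.
Proof.
move=> hq; have [C hC] := resolvent_bound hq.
have C0 : 0 <= C.
  by apply: le_trans (hC 0 _); [exact: bn_ge0|rewrite normc0].
(* [L] will be a Lipschitz constant for the rescaled resolvent whatever [t] is, since
   [normc t <= 1]; hence [n] can be fixed first. *)
pose L := C * N q * C; have L0 : 0 <= L by rewrite !mulr_ge0 ?bn_ge0.
have [n hn] : exists n, (3 / 4) ^+ n < (4 * L + 1)^-1.
  by apply: expr_small; [lra|rewrite invr_gt0; lra].
exists n; rewrite ltNge; apply/negP; set M := N _ => M1.
have M0 : 0 < M by lra.
have [t ht] := @expr_root _ (2 ^ n) (M^-1)%:C (expn_gt0 2 n).
have t1 : normc t <= 1.
  rewrite -(@expr_le1 _ (2 ^ n)) ?expn_gt0 ?normc_ge0 // -normcX ht normc_realC.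
  by rewrite ger0_norm ?invr_ge0 ?(ltW M0) // invf_le1.
have zt1 z : normc z <= 1 -> normc (z * t) <= 1.
  by move=> z1; rewrite normcM mulr_ile1 ?normc_ge0.
pose x := t *: q.
have ux m z : normc z <= 1 -> 1 - z *: x ^+ (2 ^ m) \is a GRing.unit.
  by apply: unit_pow2 => {}z z1; rewrite scalerA hq ?zt1.
pose f m z := (1 - z *: x ^+ (2 ^ m))^-1.
have fS m z : normc z = 1 -> f m.+1 (z ^+ 2) = 2^-1 *: (f m z + f m (- z)).
  move=> z1; have u1 := ux m z; have u2 := ux m (- z); rewrite normcN z1 in u1 u2.
  have {}u1 := u1 (lexx _); have {}u2 := u2 (lexx _).
  rewrite scaleNr opprK in u2.
  by rewrite /f expnSr exprM -exprZn scaleNr opprK inv_one_sub_sqr.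
have f0 z w : normc z = 1 -> normc w = 1 ->
    N (f 0 z - f 0 w) <= L * normc (z - w).
  move=> z1 w1; rewrite /f expn0 expr1 invr_sub; last 2 first.
  - by have := ux 0 z; rewrite expn0 expr1 z1; apply.
  - by have := ux 0 w; rewrite expn0 expr1 w1; apply.
  have bR s : normc s = 1 -> N (1 - s *: x)^-1 <= C.
    by move=> s1; rewrite scalerA hC ?zt1 // s1.
  have -> : 1 - w *: x - (1 - z *: x) = (z - w) *: x.
    by rewrite scalerBl opprB addrC addrA subrK.
  have bx : N ((z - w) *: x) <= normc (z - w) * N q.
    apply: le_trans (bn_scale bN _ _) _; rewrite ler_wpM2l ?normc_ge0 //.
    by apply: le_trans (bn_scale bN _ _) _; rewrite ler_piMl ?bn_ge0.
  apply: le_trans (bn_mul_le (bn_mul_le (bR _ z1) bx) (bR _ w1)) _.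
  by rewrite /L; lra.
have := circle_doubling L0 fS f0 n.
rewrite /f scaleN1r opprK scale1r; set y := x ^+ (2 ^ n); set D := _ - _ => hD.
have yM : q ^+ (2 ^ n) = M%:C *: y.
  by rewrite /y exprZn ht scalerA -rmorphM /= divff ?scale1r ?gt_eqF.
have y1 : N y <= 1.
  rewrite /y exprZn ht (le_trans (bn_scale bN _ _)) // normc_realC -/M.
  by rewrite ger0_norm ?invr_ge0 ?(ltW M0) // mulVf ?gt_eqF.
have y2 : 1 <= N y.
  have := bn_scale bN M%:C y; rewrite -yM normc_realC ger0_norm ?(ltW M0) // -/M.
  by rewrite -{1}(mulr1 M) ler_pM2l.
have u1 := ux n 1; have u2 := ux n (- 1); rewrite normcN normc1 in u1 u2.
have {}u1 := u1 (lexx _); have {}u2 := u2 (lexx _).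
rewrite scale1r -/y in u1; rewrite scaleN1r opprK -/y in u2.
(* This yields [N y <= 4 * L * (3 / 4) ^+ n < 1], against [y2]. *)
have e : y = 2^-1 *: ((1 + y) * D * (1 - y)).
  rewrite /D [(1 + y) * _]mulrBr mulrBl mulrVK // mulrV // mul1r opprB.
  by rewrite [1 + y]addrC addrACA subrr addr0 scaler_half_double.
have b1 : N (1 + y) <= 2.
  by apply: le_trans (bn_triangle bN _ _) _; have := bn_one bN; lra.
have b2 : N (1 - y) <= 2.
  by apply: le_trans (bn_sub _ _) _; have := bn_one bN; lra.
have := bn_scale bN 2^-1 ((1 + y) * D * (1 - y)); rewrite -e.
rewrite normc_half.
have := bn_mul_le (bn_mul_le b1 hD) b2.
have := ltW hn; rewrite -(ler_pM2l (x := 4 * L + 1)); last by lra.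
rewrite divff; last by rewrite gt_eqF //; lra.
have : 0 < (3 / 4 : R) ^+ n by rewrite exprn_gt0 // divr_gt0.
lra.
Qed.

Lemma cayley_comm x : 1 + x \is a GRing.unit ->
  (1 + x)^-1 * (1 - x) = (1 - x) * (1 + x)^-1.
Proof.
move=> u; apply/esym/commrV; apply: commrD; first exact: commr1.
by apply/commr_sym/commrB; [exact: commr1|].
Qed.

Lemma cayley_affine z x :
  (1 + x) - z *: (1 - x) = (1 - z)%:A + (1 + z) *: x.
Proof.
by rewrite scalerBr scalerBl scalerDl !scale1r opprB (AC (2*2) ((1*4)*(2*3))).
Qed.

(** Up to the unit [1 + x], the element is [(1 - z) + (1 + z) x = - (1 + z) (l - x)] with
    [l = - (1 - z) / (1 + z)] in the closed left half plane; at [z = -1] it is the constant 2. *)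
Lemma cayley_resolvent x :
  (forall l, complex.Re l <= 0 -> l%:A - x \is a GRing.unit) ->
  1 + x \is a GRing.unit /\
  forall z, normc z <= 1 -> 1 - z *: ((1 + x)^-1 * (1 - x)) \is a GRing.unit.
Proof.
move=> h; have u1 : 1 + x \is a GRing.unit.
  have := h (- 1); rewrite scaleN1r -opprD unitrN; apply.
  by rewrite /= oppr_le0 ler01.
split=> // z z1.
suff u : (1 + x) - z *: (1 - x) \is a GRing.unit.
  by rewrite -[1 in X in X - _](mulVr u1) scalerAr -mulrBr unitrMl ?unitrV.
rewrite cayley_affine.
have [->|z2] := eqVneq z (- 1).
  rewrite opprK subrr scale0r addr0 -[X in X *: _]/(2%:R).
  by rewrite scaler_unit ?unitr1 // unitfE pnatr_eq0.
have zne : 1 + z != 0 by rewrite addrC addr_eq0.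
pose l := - ((1 - z) / (1 + z)).
have -> : (1 - z)%:A + (1 + z) *: x = - (1 + z) *: (l%:A - x).
  by rewrite scalerBr scalerA mulrNN mulrC divfK // scaleNr opprK.
rewrite scaler_unit ?unitfE ?oppr_eq0 // h // /l.
by have := Re_cayley_ge0 z1 z2; case: (_ / _) => c d /=; lra.
Qed.

(** Up to a nonzero scalar and the unit [1 + x], [l - x] is [1 - c q] with [q] the Cayley transform
    and [c = (1 + l) / (1 - l)], of modulus at most 1. By [unit_sub_pow2] one small power of [q]
    suffices. *)
Lemma cayley_spectrum x n : 1 + x \is a GRing.unit ->
  N (((1 + x)^-1 * (1 - x)) ^+ (2 ^ n)) < 1 ->
  forall l, complex.Re l <= 0 -> l%:A - x \is a GRing.unit.
Proof.
move=> u1 hn l hl; set q := _ * _ in hn.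
have l1 : 1 - l != 0.
  apply/eqP => e; have := congr1 (@complex.Re R) e.
  by move: hl; case: (l) => a b /=; lra.
have -> : l%:A - x = - (2^-1 * (1 - l)) *: ((1 + x) * (1 - ((1 + l) / (1 - l)) *: q)).
  rewrite [(1 + x) * _]mulrBr [(1 + x) * 1]mulr1 -scalerAr /q mulVKr //.
  rewrite cayley_affine scalerDr !scalerA -scaleN1r.
  by congr (_ *: _ + _ *: _); field.
rewrite scaler_unit; last first.
  by rewrite unitfE oppr_eq0 mulf_neq0 ?invr_eq0 ?pnatr_eq0.
rewrite unitrMr //; apply: (unit_sub_pow2 (n := n)); apply: neumann.
rewrite exprZn (le_lt_trans (bn_scale bN _ _)) // normcX (le_lt_trans _ hn) //.
rewrite ler_piMl ?bn_ge0 // exprn_ile1 ?normc_ge0 //.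
rewrite normcM normcV ler_pdivrMr ?mul1r; last first.
  by rewrite lt_neqAle normc_ge0 eq_sym andbT; apply: contraNneq l1 => /eq0_normc ->.
rewrite -(ler_pXn2r (n := 2)) ?nnegrE ?normc_ge0 // !normc_sqrE.
by move: hl; case: (l) => a b /=; nra.
Qed.

Lemma sqrt_unique x y : x ^+ 2 = y ^+ 2 ->
  (forall l, complex.Re l <= 0 -> l%:A - x \is a GRing.unit) ->
  (forall l, complex.Re l <= 0 -> l%:A - y \is a GRing.unit) -> x = y.
Proof.
move=> xy hx hy.
have [ux] := cayley_resolvent hx; set p := _ * _ => /spectral_radius_lt1[m hm].
have [uy] := cayley_resolvent hy; set q := _ * _ => /spectral_radius_lt1[n hn].
(* So [x - y] intertwines [x] with [- y], hence [1 - x] with [1 + y] and [1 + x] with [1 - y]; this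
   gives [e1]. *)
have e : x * (x - y) = - ((x - y) * y).
  by rewrite mulrBr mulrBl -!expr2 xy opprB addrC.
have e1 : p * (x - y) * q = x - y.
  rewrite /q cayley_comm // /p -!mulrA; apply: (mulrI ux); rewrite mulVKr //.
  apply: (mulIr uy); rewrite -!mulrA mulVr // mulr1.
  rewrite !mulrA.
  have -> : (1 - x) * (x - y) = (x - y) * (1 + y).
    by rewrite mulrBl mul1r e opprK mulrDr mulr1.
  have -> : (1 + x) * (x - y) = (x - y) * (1 - y).
    by rewrite mulrDl mul1r e mulrBr mulr1.
  rewrite -!mulrA -one_sub_sqr; congr (_ * _).
  by have := one_sub_sqr (- y); rewrite opprK sqrrN => <-.
have eX k : p ^+ k * (x - y) * q ^+ k = x - y.
  elim: k => [|k IH]; first by rewrite !expr0 mul1r mulr1.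
  by rewrite exprSr exprS -[RHS]IH -{2}e1 !mulrA.
apply: bn_eq; rewrite leNgt; apply/negP => d0.
have := bn_mul bN (p ^+ (2 ^ (m + n)) * (x - y)) (q ^+ (2 ^ (m + n))).
rewrite eX leNgt => /negP; apply.
(* Passes to the common exponent [2 ^ (m + n)], where both powers have norm below 1. *)
have lt1 u i j : N (u ^+ (2 ^ i)) < 1 -> N (u ^+ (2 ^ (i + j))) < 1.
  move=> hu; rewrite expnD exprM (le_lt_trans (bn_expr _ _)) //.
  by rewrite exprn_ilt1 ?bn_ge0 // -lt0n expn_gt0.
have P1 := lt1 p m n hm; have := lt1 q n m hn; rewrite addnC => Q1.
have h1 : N (p ^+ (2 ^ (m + n)) * (x - y)) <= N (x - y).
  by rewrite (le_trans (bn_mul bN _ _)) // ler_piMl ?(ltW d0) ?(ltW P1).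
by rewrite (le_lt_trans (ler_wpM2r (bn_ge0 _) h1)) // gtr_pMr.
Qed.

End BanachAlgebra.

(** * Accretive elements and the arithmetic-harmonic iteration *)

Section AccretiveMean.
Local Open Scope complex_scope.
Context {R : realType} {B : unitAlgType R[i]} {N : B -> R}.
Implicit Types (x y v w : B) (c d e t : R) (k : R[i]).

(* [acc d x] abstracts the bound [Re <x u, u> >= d |u|^2]. *)
Record accretivity (acc : R -> B -> Prop) : Prop := Accretivity {
  acc_one : acc 1 1;
  acc_le : forall d e x, e <= d -> acc d x -> acc e x;
  acc_add : forall d e x y, acc d x -> acc e y -> acc (d + e) (x + y);
  acc_scale : forall d t x, 0 <= t -> acc d x -> acc (t * d) (t%:C *: x);
  acc_unit : forall d x, 0 < d -> acc d x -> x \is a GRing.unit;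
  acc_inv_norm : forall d x, 0 < d -> acc d x -> N x^-1 <= d^-1;
  acc_inv : forall d x, 0 < d -> acc d x -> exists2 e, 0 < e & acc e x^-1;
  acc_harmonic : forall d x y, 0 < d -> acc d x -> acc d y ->
    acc d (2 *: (x^-1 + y^-1)^-1);
  acc_lim : forall d (u : nat -> B) l (K rho : R), 0 <= rho < 1 ->
    (forall n, acc d (u n)) -> (forall n, N (u n - l) <= K * rho ^+ n) ->
    acc d l }.

(** A difference of squares: the [x^-1] in the middle cancels the mixed terms without
    commutativity. *)
Lemma sandwich_affine k x y : x \is a GRing.unit ->
  (x - k *: y) * x^-1 * (x + k *: y) = x - k ^+ 2 *: (y * x^-1 * y).
Proof.
move=> ux; rewrite mulrBl mulrV // mulrDr !mulrBl !mul1r -!scalerAl mulrVK //.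
by rewrite -scalerAr scalerA -expr2 addrA subrK.
Qed.

Lemma harmonicE x y : x \is a GRing.unit -> y \is a GRing.unit ->
  x + y \is a GRing.unit -> (x^-1 + y^-1)^-1 = y * (x + y)^-1 * x.
Proof.
move=> ux uy us; rewrite invr_add // [y + x]addrC.
by rewrite !invrM ?unitrMl ?unitrV // !invrK mulrA.
Qed.

(** The line through [x] at [k = 1] and [y] at [k = -1]. For the inverses of the iterates and
    [k = Re z] it is the inverse of [p_n(z)]. *)
Definition pencil k x y := 2^-1 *: ((1 + k) *: x + (1 - k) *: y).

Lemma pencilE k x y : pencil k x y = 2^-1 *: ((x + y) + k *: (x - y)).
Proof.
rewrite /pencil !scalerDl scalerBr !scale1r scaleNr.
by rewrite (AC (2*2) ((1*3)*(2*4))).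
Qed.

Lemma pencilN k x y : pencil (- k) x y = 2^-1 *: ((x + y) - k *: (x - y)).
Proof. by rewrite pencilE scaleNr. Qed.

Lemma pencilB k l x y : pencil k x y - pencil l x y = (2^-1 * (k - l)) *: (x - y).
Proof.
rewrite !pencilE -scalerBr opprD addrACA subrr add0r -scalerBl scalerA //.
Qed.

(* The arithmetic-harmonic step is angle doubling: for [k] the cosine of an
   angle, [2 k^2 - 1] is the cosine of the double. *)
Lemma pencil_doubling k x y : x \is a GRing.unit -> y \is a GRing.unit ->
  x + y \is a GRing.unit ->
  pencil k x y \is a GRing.unit -> pencil (- k) x y \is a GRing.unit ->
  (pencil (2 * k ^+ 2 - 1) (2 *: (x^-1 + y^-1)^-1) (2^-1 *: (x + y)))^-1 =
  2^-1 *: ((pencil k x y)^-1 + (pencil (- k) x y)^-1).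
Proof.
move=> ux uy us u1 u2; set S := x + y; set D := x - y.
pose T := D * S^-1 * D.
have h2 : (2 : R[i]) != 0 by rewrite pnatr_eq0.
(* [e1] is the case [k = 1] of [e2]; together they express the product in [e2] through the two
   means. *)
have e1 : 4 *: (y * S^-1 * x) = S - T.
  have := sandwich_affine 1 D us; rewrite !scale1r expr1n scale1r -/S -/T => <-.
  have -> : S - D = 2 *: y by rewrite /S /D opprB addrC addrA subrK scaler_nat mulr2n.
  have -> : S + D = 2 *: x by rewrite /S /D addrACA subrr addr0 scaler_nat mulr2n.
  by rewrite -!scalerAl -scalerAr scalerA -natrM.
have e2 : 4 *: (pencil (- k) x y * S^-1 * pencil k x y) = S - k ^+ 2 *: T.
  rewrite -sandwich_affine // pencilN pencilE -!scalerAl -scalerAr !scalerA.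
  by rewrite (_ : 4 / 2 / 2 = 1) ?scale1r //; field.
have e3 : pencil (- k) x y + pencil k x y = S.
  rewrite addrC pencilN pencilE -scalerDr addrACA subrr addr0.
  exact: scaler_half_double.
have e4 : pencil (2 * k ^+ 2 - 1) (2 *: (x^-1 + y^-1)^-1) (2^-1 *: (x + y)) =
    2 *: (pencil (- k) x y * S^-1 * pencil k x y).
  apply: (scalerI h2); rewrite /= [RHS]scalerA -natrM e2.
  rewrite harmonicE // /pencil scalerA divff // scale1r !scalerA.
  have -> : (1 + (2 * k ^+ 2 - 1)) * 2 = k ^+ 2 * 4 by ring.
  rewrite -[(_ * 4) *: _]scalerA -/S e1.
  have -> : (1 - (2 * k ^+ 2 - 1)) / 2 = 1 - k ^+ 2 by field.
  by rewrite scalerBr scalerBl scale1r addrC addrA subrK.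
rewrite e4 invr_add // e3 invrZ ?unitfE //; last first.
  by rewrite !unitrMl ?unitrV.
by rewrite !invrM ?unitrMl ?unitrV // invrK mulrA.
Qed.

Definition ahm_step (p : B * B) : B * B :=
  (2^-1 *: (p.1 + p.2), 2 *: (p.1^-1 + p.2^-1)^-1).

Definition ahm (a b : B) n : B * B := iter n ahm_step (a, b).

Lemma ahmS a b n : ahm a b n.+1 = ahm_step (ahm a b n).
Proof. by []. Qed.

(** Inversion exchanges arithmetic and harmonic means. *)
Lemma ahm_stepV (p : B * B) :
  p.1 + p.2 \is a GRing.unit -> p.1^-1 + p.2^-1 \is a GRing.unit ->
  (ahm_step p).1^-1 = 2 *: (p.1^-1^-1 + p.2^-1^-1)^-1 /\
  (ahm_step p).2^-1 = 2^-1 *: (p.1^-1 + p.2^-1).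
Proof.
have h2 : (2 : R[i]) \is a GRing.unit by rewrite unitfE pnatr_eq0.
by move=> u1 u2; rewrite /= !invrZ ?unitrV // !invrK.
Qed.

(** The harmonic mean is both [2 x (x + y)^-1 y] and [2 y (x + y)^-1 x]. Choosing in each term the
    form that exposes [w] leaves [w (x + y)^-1 (x + y)], or its mirror image. *)
Lemma ahm_step_invariant x y v w : x \is a GRing.unit -> y \is a GRing.unit ->
  x + y \is a GRing.unit -> x * v * y = w -> y * v * x = w ->
  let p := ahm_step (x, y) in p.1 * v * p.2 = w /\ p.2 * v * p.1 = w.
Proof.
move=> ux uy us h1 h2 /=; have e1 := harmonicE ux uy us.
have e2 : (x^-1 + y^-1)^-1 = x * (x + y)^-1 * y.
  by rewrite addrC harmonicE 1?[y + x]addrC.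
have h2n : (2 : R[i]) != 0 by rewrite pnatr_eq0.
split; rewrite -!scalerAl -!scalerAr scalerA ?mulVf ?divff // scale1r.
- rewrite !mulrDl [X in X + _ = _](_ : _ = w * (x + y)^-1 * x); last first.
    by rewrite e1 !mulrA h1.
  by rewrite e2 !mulrA h2 -mulrDr mulrVK.
- rewrite mulrDr [X in X + _ = _](_ : _ = x * (x + y)^-1 * w); last first.
    by rewrite e2 -h2 -!mulrA.
  rewrite [X in _ + X = _](_ : _ = y * (x + y)^-1 * w); last first.
    by rewrite e1 -h1 -!mulrA.
  by rewrite -!mulrDl mulrV // mul1r.
Qed.

Context (bN : banach_norm N) {acc : R -> B -> Prop} (hacc : accretivity acc).

Lemma acc_pencil e c x y : 0 < e -> `|c| <= 1 -> acc e x -> acc e y ->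
  acc e (pencil c%:C x y).
Proof.
move=> e0; rewrite ler_norml => /andP[k1 k2] hx hy; rewrite /pencil.
have -> : 1 + c%:C = (1 + c)%:C by rewrite rmorphD rmorph1.
have -> : 1 - c%:C = (1 - c)%:C by rewrite rmorphB rmorph1.
have -> : 2^-1 = (2^-1)%:C :> R[i] by rewrite fmorphV rmorph_nat.
have h1 : 0 <= 1 + c by lra.
have h2 : 0 <= 1 - c by lra.
have h3 : 0 <= 2^-1 :> R by rewrite invr_ge0.
have := acc_scale hacc h3 (acc_add hacc (acc_scale hacc h1 hx) (acc_scale hacc h2 hy)).
by apply: (acc_le hacc); rewrite -mulrDl addrACA subrr addr0 mulrA mulVf ?mul1r.
Qed.

Lemma acc_mid e x y : acc e x -> acc e y -> acc e (2^-1 *: (x + y)).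
Proof.
move=> hx hy; have h3 : 0 <= 2^-1 :> R by rewrite invr_ge0.
have -> : 2^-1 = (2^-1)%:C :> R[i] by rewrite fmorphV rmorph_nat.
apply: (acc_le hacc) (acc_scale hacc h3 (acc_add hacc hx hy)).
by lra.
Qed.

(** * Convergence of the arithmetic-harmonic iteration *)

Section Iteration.
Context {a b : B} {d e : R} (d0 : 0 < d) (e0 : 0 < e).
Hypotheses (ha : acc d a) (hb : acc d b) (ha' : acc e a^-1) (hb' : acc e b^-1).

(** The inverses follow the same recursion with the means exchanged; their lower bound [e] is what
    bounds the norms of the iterates. *)
Lemma ahm_acc n : let p := ahm a b n in
  [/\ acc d p.1, acc d p.2, acc e p.1^-1 & acc e p.2^-1].
Proof.
elim: n => [//|n]; rewrite ahmS; set p := ahm a b n => -[h1 h2 h3 h4] /=.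
have us := acc_unit hacc (addr_gt0 d0 d0) (acc_add hacc h1 h2).
have us' := acc_unit hacc (addr_gt0 e0 e0) (acc_add hacc h3 h4).
have [e1 e2] := ahm_stepV us us'.
split; [exact: acc_mid|exact: (acc_harmonic hacc)| |].
- by rewrite e1 !invrK -(invrK p.1) -(invrK p.2); exact: (acc_harmonic hacc).
- by rewrite e2; exact: acc_mid.
Qed.

Lemma ahm_norm n : N (ahm a b n).1 <= e^-1 /\ N (ahm a b n).2 <= e^-1.
Proof.
have [_ _ h3 h4] := ahm_acc n.
by split; [rewrite -[(_).1]invrK|rewrite -[(_).2]invrK]; apply: (acc_inv_norm hacc).
Qed.

Lemma ahm_invariant v w n : a * v * b = w -> b * v * a = w ->
  let p := ahm a b n in p.1 * v * p.2 = w /\ p.2 * v * p.1 = w.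
Proof.
move=> h1 h2; elim: n => [//|n]; have [] := ahm_acc n.
rewrite ahmS; case: (ahm a b n) => x y /= hx hy _ _ [e1 e2].
apply: ahm_step_invariant => //.
- exact: (acc_unit hacc d0 hx).
- exact: (acc_unit hacc d0 hy).
- exact: (acc_unit hacc (addr_gt0 d0 d0) (acc_add hacc hx hy)).
Qed.

Lemma ahm_limit : exists G K, [/\ acc d G,
  forall n, N ((ahm a b n).1 - G) <= K * (3 / 4) ^+ n &
  forall n, N ((ahm a b n).2 - G) <= K * (3 / 4) ^+ n].
Proof.
pose f n (z : R[i]) :=
  (pencil (complex.Re z)%:C (ahm a b n).1^-1 (ahm a b n).2^-1)^-1.
have Re1 (z : R[i]) : normc z = 1 -> `|complex.Re z| <= 1.
  by move=> z1; rewrite (le_trans (Re_le_normc _)) ?z1.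
have accp n (k : R) : `|k| <= 1 -> acc e (pencil k%:C (ahm a b n).1^-1 (ahm a b n).2^-1).
  by move=> k1; have [_ _ ? ?] := ahm_acc n; exact: acc_pencil.
have up n (c : R) hc := acc_unit hacc e0 (accp n c hc).
(* [pencil_doubling] is applied to the inverses of the iterates, whose means are the inverses of the
   next pair; [Re (z ^+ 2) = 2 k ^+ 2 - 1] on the circle. *)
have fS n z : normc z = 1 -> f n.+1 (z ^+ 2) = 2^-1 *: (f n z + f n (- z)).
  move=> z1; rewrite /f; set k := complex.Re z.
  have -> : complex.Re (- z) = - k by rewrite /k; case: (z).
  have -> : complex.Re (z ^+ 2) = 2 * k ^+ 2 - 1.
    have : normc z ^+ 2 = 1 by rewrite z1 expr1n.
    by rewrite normc_sqrE /k; case: (z) => c s /=; rewrite !expr2 /= => h; lra.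
  have k1 := Re1 _ z1; have [h1 h2 h3 h4] := ahm_acc n.
  have u1 := up n k k1; have u2 : _ \is a GRing.unit := up n (- k) _.
  rewrite normrN in u2; have {}u2 := u2 k1.
  rewrite rmorphB rmorphM rmorphXn rmorph1 rmorph_nat; rewrite rmorphN in u2 *.
  rewrite -pencil_doubling //.
  - have [|| e1 e2] := ahm_stepV (p := ahm a b n).
    + exact: (acc_unit hacc (addr_gt0 d0 d0) (acc_add hacc h1 h2)).
    + exact: (acc_unit hacc (addr_gt0 e0 e0) (acc_add hacc h3 h4)).
    by rewrite ahmS e1 e2.
  - by rewrite unitrV (acc_unit hacc d0 h1).
  - by rewrite unitrV (acc_unit hacc d0 h2).
  - exact: (acc_unit hacc (addr_gt0 e0 e0) (acc_add hacc h3 h4)).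
pose L := e^-1 * (2^-1 * N (a^-1 - b^-1)) * e^-1.
have L0 : 0 <= L by rewrite !mulr_ge0 ?invr_ge0 ?(ltW e0) ?(bn_ge0 bN).
have f0 (z w : R[i]) : normc z = 1 -> normc w = 1 ->
    N (f 0%N z - f 0%N w) <= L * normc (z - w).
  move=> z1 w1; rewrite /f invr_sub ?up ?Re1 // pencilB.
  have hb1 (s : R[i]) : normc s = 1 -> N (pencil (complex.Re s)%:C a^-1 b^-1)^-1 <= e^-1.
    by move=> s1; apply: (acc_inv_norm hacc) => //; exact: (accp 0%N _ (Re1 _ s1)).
  have hm : N ((2^-1 * ((complex.Re w)%:C - (complex.Re z)%:C)) *: (a^-1 - b^-1)) <=
      normc (z - w) * (2^-1 * N (a^-1 - b^-1)).
    rewrite (le_trans (bn_scale bN _ _)) // normcM normc_half -rmorphB normc_realC.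
    rewrite mulrA ler_wpM2r ?(bn_ge0 bN) // mulrC ler_wpM2r ?invr_ge0 //.
    rewrite distrC (le_trans _ (Re_le_normc _)) //.
    by case: (z); case: (w).
  apply: le_trans (bn_mul_le bN (bn_mul_le bN (hb1 _ z1) hm) (hb1 _ w1)) _.
  by rewrite /L; lra.
(* The values of [f n] at 1 and -1 are the two iterates. *)
have hd n : N ((ahm a b n).1 - (ahm a b n).2) <= 2 * L * (3 / 4) ^+ n.
  have := circle_doubling bN L0 fS f0 n.
  rewrite /f /= rmorphN rmorph1 /pencil opprK subrr !scale0r addr0 add0r.
  by rewrite !scalerA mulVf ?scale1r ?invrK // -[1 + 1]/(2%:R) pnatr_eq0.
have r1 : 0 <= (3 / 4 : R) < 1 by lra.
have hs n : N ((ahm a b n.+1).1 - (ahm a b n).1) <= L * (3 / 4) ^+ n.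
  have := hd n; rewrite ahmS; case: (ahm a b n) => x y /= h.
  have -> : 2^-1 *: (x + y) - x = - (2^-1 *: (x - y)).
    rewrite -{2}(scaler_half_double x) -scalerBr opprD addrACA subrr add0r.
    by rewrite -scalerN opprB.
  rewrite (bn_opp bN) (le_trans (bn_scale bN _ _)) // normc_half; lra.
have [G hG] := bn_complete bN r1 hs.
(* The first term is the rate for the first iterate; [2 * L] adds the gap to the second. *)
exists G, (L / (1 - 3 / 4) + 2 * L); split.
- by apply: (acc_lim hacc r1 _ hG) => n; have [] := ahm_acc n.
- move=> n; apply: le_trans (hG n) _; rewrite [leRHS]mulrDl lerDl.
  by apply: mulr_ge0; [lra|apply: exprn_ge0; lra].
- move=> n; set x := _.2; have -> : x - G = ((ahm a b n).1 - G) - ((ahm a b n).1 - x).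
    by rewrite opprB [RHS]addrC addrA subrK.
  by rewrite (le_trans (bn_sub bN _ _)) // [leRHS]mulrDl lerD.
Qed.

Lemma ahm_limit_invariant G K v w :
  (forall n, N ((ahm a b n).1 - G) <= K * (3 / 4) ^+ n) ->
  (forall n, N ((ahm a b n).2 - G) <= K * (3 / 4) ^+ n) ->
  a * v * b = w -> b * v * a = w -> G * v * G = w.
Proof.
move=> h1 h2 e1 e2; have r1 : 0 <= (3 / 4 : R) < 1 by lra.
apply: (geometric_eq bN (K := K * N v * N G + e^-1 * N v * K) r1) => n.
have [<- _] := ahm_invariant n e1 e2; have [n1 _] := ahm_norm n.
have := h1 n; have := h2 n; case: (ahm a b n) n1 => x y /= n1 hy hx.
have -> : G * v * G - x * v * y = - ((x - G) * v * G + x * v * (y - G)).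
  by rewrite !mulrBl mulrBr [X in _ = - X]addrC addrA subrK opprB.
rewrite (bn_opp bN) (le_trans (bn_triangle bN _ _)) //.
have := bn_mul_le bN (bn_mul_le bN hx (lexx (N v))) (lexx (N G)).
have := bn_mul_le bN (bn_mul_le bN n1 (lexx (N v))) hy.
lra.
Qed.

End Iteration.

(** * The geometric mean of strictly accretive elements *)

Definition strictly_acc x := exists2 d, 0 < d & acc d x.

Lemma strictly_acc_unit x : strictly_acc x -> x \is a GRing.unit.
Proof. by case=> d d0 /(acc_unit hacc d0). Qed.

Lemma strictly_acc_add x y : strictly_acc x -> strictly_acc y -> strictly_acc (x + y).
Proof.
move=> [d d0 hx] [e e0 hy]; exists (d + e); first exact: addr_gt0.
exact: (acc_add hacc).
Qed.

Lemma strictly_acc_inv x : strictly_acc x -> strictly_acc x^-1.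
Proof. by move=> [d d0 hx]; exact: (acc_inv hacc d0 hx). Qed.

Lemma strictly_acc_uniform x y : strictly_acc x -> strictly_acc y ->
  exists d, [/\ 0 < d, acc d x & acc d y].
Proof.
move=> [d d0 hx] [e e0 hy]; exists (Num.min d e); split.
- by rewrite lt_min d0.
- by apply: (acc_le hacc) hx; rewrite ge_min lexx.
- by apply: (acc_le hacc) hy; rewrite ge_min lexx orbT.
Qed.

Definition resolvent_left_half x :=
  forall k, complex.Re k <= 0 -> k%:A - x \is a GRing.unit.

(* With [t := x^-1 G], Newton's step [x |-> (x + G x^-1 G) / 2] squares the
   Cayley transform of [t]. *)
Lemma newton_cayley x G : x \is a GRing.unit -> x + G \is a GRing.unit ->
  let x' := 2^-1 *: (x + G * x^-1 * G) in
  (x' + G)^-1 * (x' - G) = ((x + G)^-1 * (x - G)) ^+ 2.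
Proof.
move=> ux us x'; pose t := x^-1 * G.
have eG : G = x * t by rewrite mulVKr.
have ut : 1 + t \is a GRing.unit.
  by rewrite -(unitrMr _ ux) mulrDr mulr1 -eG.
have ep : x + G = x * (1 + t) by rewrite mulrDr mulr1 -eG.
have em : x - G = x * (1 - t) by rewrite mulrBr mulr1 -eG.
have e1 : G * x^-1 * G = x * t ^+ 2.
  by rewrite expr2 mulrA -eG /t mulrA.
have e2 : x' + G = 2^-1 *: (x * (1 + t) ^+ 2).
  rewrite -[G in LHS]scaler_half_double -scalerDr e1; congr (_ *: _).
  by rewrite [1 + t]addrC sqrrD1 !mulrDr mulr1 -eG (AC (2*1) (2*3*1)).
have e3 : x' - G = 2^-1 *: (x * (1 - t) ^+ 2).
  rewrite -[G in LHS]scaler_half_double -scalerBr e1; congr (_ *: _).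
  rewrite -[1 - t]opprB sqrrN sqrrB1 mulrDr mulrBr mulr1 mulr2n mulrDr -eG.
  by rewrite (AC (2*1) (2*3*1)).
have h2 : (2^-1 : R[i]) \is a GRing.unit by rewrite unitrV unitfE pnatr_eq0.
rewrite e2 e3 ep em invrZ ?unitrMl ?unitrX // -scalerAl -scalerAr scalerA.
rewrite mulVf ?scale1r -?unitfE // (invrM ux (unitrX 2 ut)) (invrM ux ut).
rewrite -!mulrA !mulKr // -exprVn exprMn_comm //.
apply/commr_sym/commrV/commr_sym; rewrite /GRing.comm -one_sub_sqr.
by have := one_sub_sqr (- t); rewrite opprK sqrrN => <-.
Qed.

Theorem geometric_mean_exists a b : strictly_acc a -> strictly_acc b ->
  exists G, [/\ strictly_acc G, G * a^-1 * G = b,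
    forall x, strictly_acc x -> x * a^-1 * x = b -> x = G &
    resolvent_left_half (a^-1 * G)].
Proof.
move=> ha hb; have [d [d0 hda hdb]] := strictly_acc_uniform ha hb.
have [e [e0 hea heb]] := strictly_acc_uniform (strictly_acc_inv ha) (strictly_acc_inv hb).
have [G [K [hG h1 h2]]] := ahm_limit d0 e0 hda hdb hea heb.
have inv v w := ahm_limit_invariant d0 e0 hda hdb hea heb (v := v) (w := w) h1 h2.
have ua := strictly_acc_unit ha; have ub := strictly_acc_unit hb.
have sG : strictly_acc G by exists d.
have uG := strictly_acc_unit sG.
have sol x : strictly_acc x -> x * a^-1 * x = b ->
    a * x^-1 * b = x /\ b * x^-1 * a = x.
  move=> /strictly_acc_unit ux <-; split; first by rewrite !mulrA mulrVK // mulrV ?mul1r.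
  by rewrite mulrK // mulrVK.
have eG : G * a^-1 * G = b by apply: inv; [rewrite mulrV ?mul1r|rewrite mulrVK].
exists G; split=> //.
- move=> x sx ex; have [e1 e2] := sol x sx ex; have := inv _ _ e1 e2.
  have ux := strictly_acc_unit sx => e3.
  (* As [x + G = x (1 + s)] is a unit, so is [s + 1], and [s ^+ 2 = 1] then forces [s = 1]. *)
  have := strictly_acc_unit (strictly_acc_add sx sG).
  pose s := x^-1 * G; have es : G = x * s by rewrite mulVKr.
  rewrite es -[X in X + _]mulr1 -mulrDr unitrMr // addrC => us.
  suff -> : s = 1 by rewrite mulr1.
  apply/eqP; rewrite -subr_eq0; apply/eqP/(mulIr us); rewrite mul0r -subr_sqr_1.
  by rewrite expr2 /s mulrA -[_ * G * _]mulrA -(mulrA x^-1) e3 mulVr ?subrr.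
- have [e1 e2] := sol G sG eG.
  pose q n := ((ahm a b n).1 + G)^-1 * ((ahm a b n).1 - G).
  have acc2 n : acc (d + d) ((ahm a b n).1 + G).
    by have [hn _ _ _] := ahm_acc d0 e0 hda hdb hea heb n; exact: (acc_add hacc).
  have d20 : 0 < d + d by rewrite addr_gt0.
  (* The invariant with [v = G^-1] gives [y = G x^-1 G] for each pair [(x, y)], so the arithmetic
     mean is a Newton step. *)
  have qS n : q n = q 0%N ^+ (2 ^ n).
    elim: n => [|n IH]; first by rewrite expr1.
    rewrite expnSr exprM -IH /q ahmS; have us := acc_unit hacc d20 (acc2 n).
    have [hn _ _ _] := ahm_acc d0 e0 hda hdb hea heb n.
    have [i1 _] := ahm_invariant d0 e0 hda hdb hea heb n e1 e2.
    have ux := acc_unit hacc d0 hn.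
    case: (ahm a b n) us i1 ux => x y /= us i1 ux.
    have -> : y = G * x^-1 * G by rewrite -{2}i1 !mulrA mulrVK // mulrV // mul1r.
    exact: newton_cayley.
  have us := acc_unit hacc d20 (acc2 0%N).
  have et : a + G = a * (1 + a^-1 * G) by rewrite mulrDr mulr1 mulVKr.
  have ut : 1 + a^-1 * G \is a GRing.unit by rewrite -(unitrMr _ ua) -et.
  have eq : (1 + a^-1 * G)^-1 * (1 - a^-1 * G) = q 0%N.
    rewrite /q /= et invrM // -mulrA; congr (_ * _).
    by rewrite mulrBr mulVr.
  (* Makes [(d + d)^-1 * (K * (3 / 4) ^+ n)], a bound for [N (q n)], less than 1; [|K| + 1] is
     positive whatever [K] is. *)
  have [n hn] : exists n, (3 / 4) ^+ n < (d + d) / (`|K| + 1).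
    by apply: expr_small; [lra|rewrite divr_gt0 // ltr_pwDr].
  apply: (cayley_spectrum bN (n := n)) => //; rewrite eq -qS /q.
  have hq := acc_inv_norm hacc d20 (acc2 n).
  apply: le_lt_trans (bn_mul_le bN hq (h1 n)) _.
  rewrite mulrC ltr_pdivrMr // mul1r.
  have {}hn : (3 / 4) ^+ n * (`|K| + 1) < d + d.
    by rewrite -ltr_pdivlMr // ltr_pwDr.
  rewrite (le_lt_trans _ hn) // mulrC ler_wpM2l ?exprn_ge0 ?divr_ge0 //.
  by rewrite (le_trans (ler_norm K)) // lerDl.
Qed.

Definition is_sqrt x r := r ^+ 2 = x /\ resolvent_left_half r.

Lemma is_sqrt_unique x r r' : is_sqrt x r -> is_sqrt x r' -> r = r'.
Proof. by move=> [e h] [e' h']; apply: (sqrt_unique bN) => //; rewrite e. Qed.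

Lemma is_sqrt_unit x r : is_sqrt x r -> r \is a GRing.unit.
Proof. by case=> _ /(_ 0 (lexx _)); rewrite scale0r sub0r unitrN. Qed.

(** The square root is the geometric mean of 1 and [a]. *)
Lemma strictly_acc_sqrt a : strictly_acc a -> exists r, is_sqrt a r.
Proof.
move=> ha; have h1 : strictly_acc 1 by exists 1 => //; exact: (acc_one hacc).
have [G [_ e _ hG]] := geometric_mean_exists h1 ha.
by exists G; move: e hG; rewrite invr1 mulr1 mul1r.
Qed.

(** Since [r^-1 a r^-1 = 1], the element is [- r^-1 (t a + b) r^-1], and [t a + b] is strictly
    accretive. *)
Lemma sandwich_unit a b r t : strictly_acc a -> strictly_acc b ->
  is_sqrt a r -> 0 <= t -> (- t%:C)%:A - r^-1 * b * r^-1 \is a GRing.unit.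
Proof.
move=> ha hb hr; have ur := is_sqrt_unit hr; have [er _] := hr.
rewrite le_eqVlt => /orP[/eqP <-|t0].
  rewrite oppr0 scale0r sub0r unitrN unitrMl ?unitrMr ?unitrV //.
  exact: strictly_acc_unit.
have -> : (- t%:C)%:A - r^-1 * b * r^-1 = - (r^-1 * (t%:C *: a + b) * r^-1).
  rewrite mulrDr mulrDl -scalerAr -scalerAl -er expr2 mulKr // mulrV //.
  by rewrite scaleNr opprD.
rewrite unitrN unitrMl ?unitrMr ?unitrV //.
apply: strictly_acc_unit; apply: strictly_acc_add => //.
have [d d0 hd] := ha; exists (t * d); first exact: mulr_gt0.
exact: (acc_scale hacc (ltW t0)).
Qed.

Theorem geometric_mean_formula a b : strictly_acc a -> strictly_acc b ->
  exists G, [/\ strictly_acc G, G * a^-1 * G = b,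
    forall x, strictly_acc x -> x * a^-1 * x = b -> x = G,
    forall r, is_sqrt a r ->
      exists2 s, is_sqrt (r^-1 * b * r^-1) s & r * s * r = G &
    forall r, is_sqrt b r ->
      exists2 s, is_sqrt (r^-1 * a * r^-1) s & r * s * r = G].
Proof.
have key x y G r : G * x^-1 * G = y -> resolvent_left_half (x^-1 * G) ->
    is_sqrt x r -> exists2 s, is_sqrt (r^-1 * y * r^-1) s & r * s * r = G.
  move=> eG hG hr; have ur := is_sqrt_unit hr; have [er _] := hr.
  exists (r^-1 * G * r^-1); last by rewrite !mulrA mulrV // mul1r mulrVK.
  split=> [|k k0].
    by rewrite -eG -er !expr2 invrM // !mulrA.
  (* Since [r ^+ 2 = x], [r^-1 G r^-1] is the conjugate of [x^-1 G] by [r]. *)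
  have -> : k%:A - r^-1 * G * r^-1 = r * (k%:A - x^-1 * G) * r^-1.
    rewrite mulrBr mulrBl -scalerAr mulr1 -scalerAl mulrV // -er expr2 invrM //.
    by rewrite !mulrA mulrV // mul1r.
  by rewrite unitrMl ?unitrMr ?unitrV // hG.
move=> ha hb; have [G [sG eG uniqG hG]] := geometric_mean_exists ha hb.
have [G' [sG' eG' _ hG']] := geometric_mean_exists hb ha.
have ua := strictly_acc_unit ha; have ub := strictly_acc_unit hb.
have uG' := strictly_acc_unit sG'.
(* Inverting [G' b^-1 G' = a] gives [G' a^-1 G' = b]. *)
have GG' : G' = G.
  apply: uniqG => //; rewrite -eG' !invrM ?unitrMl ?unitrMr ?unitrV // invrK.
  by rewrite !mulrA mulrV // mul1r mulrVK.
exists G; split=> // [r|r]; first exact: key.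
by rewrite -GG'; exact: key.
Qed.

End AccretiveMean.

(** * The Hilbert space *)

Section ComplexNorm.
Local Open Scope complex_scope.
Context {R : realType} {H : completeNormedModType R[i]}.
Implicit Types (u v : H) (k : R[i]).

Lemma rnormE u : `|u| = (rnorm u)%:C.
Proof. by rewrite /rnorm RRe_real // ger0_real. Qed.

Lemma rnorm_ge0 u : 0 <= rnorm u.
Proof. by rewrite -lecR -rnormE; exact: normr_ge0. Qed.

Lemma rnormD u v : rnorm (u + v) <= rnorm u + rnorm v.
Proof. by rewrite -lecR rmorphD /= -!rnormE ler_normD. Qed.

Lemma rnormZ k u : rnorm (k *: u) = normc k * rnorm u.
Proof. by apply: complexI; rewrite rmorphM /= -!rnormE -normr_normc normrZ. Qed.

Lemma rnorm0 : rnorm (0 : H) = 0.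
Proof. by apply: complexI; rewrite -rnormE normr0. Qed.

Lemma rnorm_eq0 u : rnorm u = 0 -> u = 0.
Proof. by move=> h; apply/normr0_eq0; rewrite rnormE h. Qed.

Lemma rnormN u : rnorm (- u) = rnorm u.
Proof. by apply: complexI; rewrite -!rnormE normrN. Qed.

Lemma rnormB u v : rnorm (u - v) <= rnorm u + rnorm v.
Proof. by rewrite -(rnormN v) rnormD. Qed.

Lemma geometric_series_le (f : nat -> H) (M rho : R) : 0 <= rho < 1 ->
  (forall n, rnorm (f n.+1 - f n) <= M * rho ^+ n) ->
  forall n m, rnorm (f (m + n)%N - f n) <= M / (1 - rho) * rho ^+ n.
Proof.
move=> /andP[r0 r1] h n m.
have M0 : 0 <= M by have := h 0%N; rewrite expr0 mulr1; apply: le_trans; exact: rnorm_ge0.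
have s0 : 0 < 1 - rho by rewrite subr_gt0.
(* The sharper telescoping bound is the one that the induction on [m] preserves. *)
suff : rnorm (f (m + n)%N - f n) <= M / (1 - rho) * (rho ^+ n - rho ^+ (m + n)).
  move/le_trans; apply; rewrite ler_wpM2l ?divr_ge0 ?(ltW s0) //.
  by rewrite gerBl exprn_ge0.
elim: m => [|m IH]; first by rewrite !subrr rnorm0 mulr0.
have -> : f (m.+1 + n)%N - f n = (f (m + n).+1 - f (m + n)%N) + (f (m + n)%N - f n).
  by rewrite addrA subrK addSn.
rewrite (le_trans (rnormD _ _)) //; apply: le_trans (lerD (h _) IH) _.
rewrite addSn exprS le_eqVlt; apply/orP; left; apply/eqP.
by field; rewrite gt_eqF.
Qed.

Lemma geometric_limit (f : nat -> H) (M rho : R) : 0 <= rho < 1 ->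
  (forall n, rnorm (f n.+1 - f n) <= M * rho ^+ n) ->
  exists l, forall n, rnorm (f n - l) <= M / (1 - rho) * rho ^+ n.
Proof.
move=> hr h; have hle := geometric_series_le hr h; have /andP[r0 r1] := hr.
have s0 : 0 < 1 - rho by rewrite subr_gt0.
have M0 : 0 <= M by have := h 0%N; rewrite expr0 mulr1; apply: le_trans; exact: rnorm_ge0.
set K := M / (1 - rho).
have K0 : 0 <= K by rewrite divr_ge0 // ltW.
have : cvgn f.
  apply/cauchy_cvgP/cauchy_exP => e e0.
  have [n hn] : exists n, rho ^+ n < complex.Re e / (K + 1).
    apply: expr_small => //; rewrite divr_gt0 //; last by lra.
    by move: e0; rewrite ltcE => /andP[].
  exists (f n), n => //= m /= nm; rewrite -ball_normE /= rnormE.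
  rewrite -[e]RRe_real ?gtr0_real // ltcR -opprB rnormN.
  have := hle n (m - n)%N; rewrite subnK // => /le_lt_trans; apply.
  rewrite ltr_pdivlMr in hn; last by lra.
  by apply: le_lt_trans hn; rewrite mulrC ler_wpM2l ?exprn_ge0 // -/K lerDl.
move=> /cvg_ex[l hl]; exists l => n; apply/ler_addgt0Pr => e e0.
have ec : (0 : R[i]) < e%:C by rewrite ltcR.
have /cvgrPdist_lt/(_ _ ec)[m _ hm] := hl.
have := hm (n + m)%N (leq_addl _ _) => /=; rewrite rnormE ltcR => h1.
have -> : f n - l = - (f (n + m)%N - f n) - (l - f (n + m)%N).
  by rewrite !opprB addrA subrK.
rewrite (le_trans (rnormB _ _)) // rnormN lerD ?(ltW h1) //.
by rewrite addnC hle.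
Qed.

End ComplexNorm.

(** * The real inner product and the Cauchy-Schwarz inequality *)

Section InnerProduct.
Local Open Scope complex_scope.
Context {R : realType} {H : completeNormedModType R[i]}.
Context (dot : {dot H for Num.conj}) (dotE : forall u : H, dot u u = `|u| ^+ 2).
Implicit Types (u v w : H) (k : R[i]).

Lemma Re_add k l : complex.Re (k + l) = complex.Re k + complex.Re l.
Proof. by case: k => ? ?; case: l. Qed.

Lemma Re_conj k : complex.Re (Num.conj k) = complex.Re k.
Proof. by case: k. Qed.

Lemma Re_mulr (t : R) k : complex.Re (t%:C * k) = t * complex.Re k.
Proof. by case: k => a b /=; rewrite mul0r subr0. Qed.

Definition rdot u v := complex.Re (dot u v).

Lemma rdotDl u v w : rdot (u + v) w = rdot u w + rdot v w.
Proof. by rewrite /rdot linearDl; exact: Re_add. Qed.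

Lemma rdotC u v : rdot u v = rdot v u.
Proof.
by rewrite /rdot hermC expr0 mul1r; exact: Re_conj.
Qed.

Lemma rdotDr u v w : rdot u (v + w) = rdot u v + rdot u w.
Proof. by rewrite rdotC rdotDl !(rdotC u). Qed.

Lemma rdotZl (t : R) u v : rdot (t%:C *: u) v = t * rdot u v.
Proof.
by rewrite /rdot linearZl_LR; exact: Re_mulr.
Qed.

Lemma rdotZr (t : R) u v : rdot u (t%:C *: v) = t * rdot u v.
Proof. by rewrite rdotC rdotZl rdotC. Qed.

Lemma rdot_norm u : rdot u u = rnorm u ^+ 2.
Proof. by rewrite /rdot dotE rnormE -rmorphXn. Qed.

Lemma rnorm_sqrD u v :
  rnorm (u + v) ^+ 2 = rnorm u ^+ 2 + 2 * rdot u v + rnorm v ^+ 2.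
Proof. by rewrite -!rdot_norm !rdotDl !rdotDr (rdotC v u); ring. Qed.

Lemma rnorm_sqrBZ (t : R) u v :
  rnorm (u - t%:C *: v) ^+ 2 = rnorm u ^+ 2 - 2 * t * rdot u v + t ^+ 2 * rnorm v ^+ 2.
Proof.
rewrite rnorm_sqrD rnormN rnormZ normc_realC exprMn real_normK ?num_real //.
by rewrite -scaleNr -rmorphN rdotZr; ring.
Qed.

Lemma rdot_cauchy_schwarz u v : rdot u v <= rnorm u * rnorm v.
Proof.
have [->|v0] := eqVneq v 0.
  by rewrite rnorm0 mulr0 rdotC -[0](scale0r 0) -[X in X *: _]/(0%:C) rdotZl mul0r.
have nv : 0 < rnorm v.
  by rewrite lt_neqAle rnorm_ge0 eq_sym andbT; apply: contra v0 => /eqP/rnorm_eq0 ->.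
have [->|u0] := eqVneq u 0.
  by rewrite rnorm0 mul0r -[0](scale0r 0) -[X in X *: _]/(0%:C) rdotZl mul0r.
have nu : 0 < rnorm u.
  by rewrite lt_neqAle rnorm_ge0 eq_sym andbT; apply: contra u0 => /eqP/rnorm_eq0 ->.
(* Scaling [v] to the norm of [u] turns the square into [2 (|u| / |v|) (|u| |v| - Re <u, v>)]. *)
have := sqr_ge0 (rnorm (u - (rnorm u / rnorm v)%:C *: v)); rewrite rnorm_sqrBZ.
have -> : (rnorm u / rnorm v) ^+ 2 * rnorm v ^+ 2 = rnorm u ^+ 2.
  by field; rewrite gt_eqF.
rewrite (_ : _ - _ + _ = 2 * rnorm u / rnorm v * (rnorm u * rnorm v - rdot u v)).
  rewrite pmulr_rge0 ?subr_ge0 // divr_gt0 ?mulr_gt0 //.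
by field; rewrite gt_eqF.
Qed.

Lemma cauchy_schwarz u v : normc (dot u v) <= rnorm u * rnorm v.
Proof.
have [d0|d0] := eqVneq (dot u v) 0.
  by rewrite d0 normc0 mulr_ge0 ?rnorm_ge0.
have nd : 0 < normc (dot u v).
  by rewrite lt_neqAle normc_ge0 eq_sym andbT; apply: contra d0 => /eqP/eq0_normc ->.
(* The unimodular [k] rotates [dot u v] onto its modulus, reducing to the real inequality. *)
pose k := (dot u v)^-1 * (normc (dot u v))%:C.
have k1 : normc k = 1.
  by rewrite normcM normcV normc_realC ger0_norm ?normc_ge0 // mulVf ?gt_eqF.
have := rdot_cauchy_schwarz (k *: u) v; rewrite rnormZ k1 mul1r.
by rewrite /rdot linearZl_LR /= /k mulrAC mulVf // mul1r.
Qed.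

End InnerProduct.

(** * The operator algebra as a Banach algebra *)

Section Operators.
Local Open Scope complex_scope.
Context {R : realType} {H : completeNormedModType R[i]}.
Implicit Types (u v : H) (k : R[i]) (f g : H -> H).

Lemma opD f u v : bounded_operator f -> f (u + v) = f u + f v.
Proof. by case=> lf _; have := lf 1 u v; rewrite !scale1r. Qed.

Lemma op0 f : bounded_operator f -> f 0 = 0.
Proof. by move=> bf; apply: (addrI (f 0)); rewrite -(opD _ _ bf) !addr0. Qed.

Lemma opZ f k u : bounded_operator f -> f (k *: u) = k *: f u.
Proof. by move=> bf; have [lf _] := bf; have := lf k u 0; rewrite (op0 bf) !addr0. Qed.

Lemma opnorm_le f M : 0 <= M -> (forall u, rnorm (f u) <= M * rnorm u) ->
  opnorm f <= M.
Proof.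
move=> M0 h; apply: ge_sup; first by exists (rnorm (f 0)), 0; rewrite //= rnorm0.
move=> _ [u /= u1 <-]; apply: le_trans (h u) _.
by rewrite -[leRHS]mulr1 ler_wpM2l.
Qed.

Lemma opnorm_ub f u : bounded_operator f -> rnorm u <= 1 -> rnorm (f u) <= opnorm f.
Proof.
move=> [_ [M hM]] u1; apply: ub_le_sup; last by exists u.
exists `|M| => _ [v /= v1 <-]; apply: le_trans (hM v) _.
apply: (@le_trans _ _ (`|M| * rnorm v)); first by rewrite ler_wpM2r ?rnorm_ge0 ?ler_norm.
by rewrite -[leRHS]mulr1 ler_wpM2l.
Qed.

Lemma opnorm_ge0 f : bounded_operator f -> 0 <= opnorm f.
Proof.
by move=> bf; apply: le_trans (opnorm_ub (u := 0) bf _); rewrite ?rnorm_ge0 // rnorm0.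
Qed.

Lemma opnormP f u : bounded_operator f -> rnorm (f u) <= opnorm f * rnorm u.
Proof.
move=> bf; have [->|u0] := eqVneq u 0; first by rewrite (op0 bf) rnorm0 mulr0.
have nu : 0 < rnorm u.
  by rewrite lt_neqAle rnorm_ge0 eq_sym andbT; apply: contra u0 => /eqP/rnorm_eq0 ->.
have n1 : normc (rnorm u)^-1%:C = (rnorm u)^-1.
  by rewrite normc_realC ger0_norm // invr_ge0 ltW.
have := opnorm_ub (u := (rnorm u)^-1%:C *: u) bf.
rewrite (opZ _ _ bf) !rnormZ n1 mulVf ?gt_eqF // lexx => /(_ isT).
by rewrite ler_pdivrMl // mulrC.
Qed.

Context {A : set (H -> H)}.

Record opalg_carrier := Opalg { opfun : H -> H; opfunP : A opfun }.

(* The two proofs are phantom arguments, from which the ring axioms, including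
   [1 != 0], are inferred. *)
Definition opalg of unital_operator_algebra A & exists u : H, u != 0 :=
  opalg_carrier.

End Operators.

Arguments opalg_carrier {R H} A.

(** * Algebra structure, completeness and accretivity of operators *)

Section OperatorAlgebra.
Local Open Scope complex_scope.
Context {R : realType} {H : completeNormedModType R[i]} {A : set (H -> H)}.
Context (hA : unital_operator_algebra A) (hH : exists u : H, u != 0).
Implicit Types (u v : H) (k : R[i]).

Local Notation E := (opalg hA hH).
Implicit Types x y z : E.

HB.instance Definition _ := gen_eqMixin E.
HB.instance Definition _ := gen_choiceMixin E.

Lemma opalg_inj x y : (forall u, opfun x u = opfun y u) -> x = y.
Proof.
case: x y => [f hf] [g hg] /= h; have fg : f = g by exact/funext.
by subst g; rewrite (Prop_irrelevance hf hg).
Qed.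

Lemma opalg_bounded x : bounded_operator (opfun x).
Proof. exact: (uoa_bounded hA (opfunP x)). Qed.

Definition opalg_scale k x : E := Opalg (uoa_scale hA k (opfunP x)).
Definition opalg_add x y : E := Opalg (uoa_add hA (opfunP x) (opfunP y)).
Definition opalg_mul x y : E := Opalg (uoa_mul hA (opfunP x) (opfunP y)).
Definition opalg_one : E := Opalg (uoa_one hA).
(** Zero and opposites are scalar multiples, so that closure under scaling puts them in [A]. *)
Definition opalg_zero : E := opalg_scale 0 opalg_one.
Definition opalg_opp x : E := opalg_scale (- 1) x.

Fact opalg_addA : associative opalg_add.
Proof. by move=> x y z; apply: opalg_inj => u /=; exact: addrA. Qed.
Fact opalg_addC : commutative opalg_add.
Proof. by move=> x y; apply: opalg_inj => u /=; exact: addrC. Qed.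
Fact opalg_add0 : left_id opalg_zero opalg_add.
Proof.
move=> x; apply: opalg_inj => u; rewrite -[LHS]/(0 *: u + opfun x u).
by rewrite scale0r add0r.
Qed.
Fact opalg_addN : left_inverse opalg_zero opalg_opp opalg_add.
Proof.
move=> x; apply: opalg_inj => u; rewrite -[LHS]/((- 1) *: opfun x u + opfun x u).
by rewrite -[RHS]/(0 *: u) scaleN1r addNr scale0r.
Qed.

HB.instance Definition _ :=
  GRing.isZmodule.Build E opalg_addA opalg_addC opalg_add0 opalg_addN.

Fact opalg_mulA : associative opalg_mul.
Proof. by move=> x y z; exact: opalg_inj. Qed.
Fact opalg_mul1 : left_id opalg_one opalg_mul.
Proof. by move=> x; exact: opalg_inj. Qed.
Fact opalg_mulr1 : right_id opalg_one opalg_mul.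
Proof. by move=> x; exact: opalg_inj. Qed.
Fact opalg_mulDl : left_distributive opalg_mul opalg_add.
Proof. by move=> x y z; exact: opalg_inj. Qed.
Fact opalg_mulDr : right_distributive opalg_mul opalg_add.
Proof. by move=> x y z; apply: opalg_inj => u; exact: (opD _ _ (opalg_bounded x)). Qed.
Fact opalg_one_neq0 : opalg_one != 0.
Proof.
apply/eqP => e; have [u /eqP] := hH; apply.
by have := congr1 (fun x : E => opfun x u) e; rewrite /= => ->; exact: scale0r.
Qed.

HB.instance Definition _ := GRing.Zmodule_isNzRing.Build E opalg_mulA
  opalg_mul1 opalg_mulr1 opalg_mulDl opalg_mulDr opalg_one_neq0.

Fact opalg_scaleA k l x :
  opalg_scale k (opalg_scale l x) = opalg_scale (k * l) x.
Proof. by apply: opalg_inj => u; exact: scalerA. Qed.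
Fact opalg_scale1 : left_id 1 opalg_scale.
Proof. by move=> x; apply: opalg_inj => u; exact: scale1r. Qed.
Fact opalg_scaleDr : right_distributive opalg_scale +%R.
Proof. by move=> k x y; apply: opalg_inj => u; exact: scalerDr. Qed.
Fact opalg_scaleDl x : {morph opalg_scale^~ x : k l / k + l}.
Proof. by move=> k l; apply: opalg_inj => u; exact: scalerDl. Qed.

HB.instance Definition _ := GRing.Zmodule_isLmodule.Build R[i] E
  opalg_scaleA opalg_scale1 opalg_scaleDr opalg_scaleDl.

Fact opalg_scaleAl k x y : k *: (x * y) = (k *: x) * y.
Proof. by apply: opalg_inj. Qed.
HB.instance Definition _ := GRing.Lmodule_isLalgebra.Build R[i] E opalg_scaleAl.

Fact opalg_scaleAr k x y : k *: (x * y) = x * (k *: y).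
Proof. by apply: opalg_inj => u; apply/esym/(opZ _ _ (opalg_bounded x)). Qed.
HB.instance Definition _ := GRing.Lalgebra_isAlgebra.Build R[i] E opalg_scaleAr.

(** Invertibility is relative to [A], as in [is_inverse]. Off the units the inverse defaults to the
    element itself, the convention of unit rings. *)
Definition opalg_unit : pred E := fun x => `[< exists y, y * x = 1 /\ x * y = 1 >].
Definition opalg_inv x : E := xget x [set y | y * x = 1 /\ x * y = 1].

Fact opalg_invP x : opalg_unit x -> opalg_inv x * x = 1 /\ x * opalg_inv x = 1.
Proof.
by move=> /asboolP[y hy]; rewrite /opalg_inv; case: xgetP => [z _ //|/(_ y)].
Qed.
Fact opalg_mulVr : {in opalg_unit, left_inverse 1 opalg_inv *%R}.
Proof. by move=> x /opalg_invP[]. Qed.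
Fact opalg_divrr : {in opalg_unit, right_inverse 1 opalg_inv *%R}.
Proof. by move=> x /opalg_invP[]. Qed.
Fact opalg_unitP x y : y * x = 1 /\ x * y = 1 -> opalg_unit x.
Proof. by move=> h; apply/asboolP; exists y. Qed.
Fact opalg_inv_out : {in [predC opalg_unit], opalg_inv =1 id}.
Proof.
move=> x /asboolP h; rewrite /opalg_inv; case: xgetP => // y _ hy.
by case: h; exists y.
Qed.

HB.instance Definition _ := GRing.NzRing_hasMulInverse.Build E
  opalg_mulVr opalg_divrr opalg_unitP opalg_inv_out.

Definition opalg_norm x : R := opnorm (opfun x).

Lemma opfun_add x y u : opfun (x + y) u = opfun x u + opfun y u.
Proof. by []. Qed.

Lemma opfun_scale k x u : opfun (k *: x) u = k *: opfun x u.
Proof. by []. Qed.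

Lemma opfun_mul x y u : opfun (x * y) u = opfun x (opfun y u).
Proof. by []. Qed.

Lemma opfun_one u : opfun (1 : E) u = u.
Proof. by []. Qed.

Lemma opfun_opp x u : opfun (- x) u = - opfun x u.
Proof. exact: scaleN1r. Qed.

Lemma opfun_sub x y u : opfun (x - y) u = opfun x u - opfun y u.
Proof. by rewrite opfun_add opfun_opp. Qed.

Lemma opfunK x u : x \is a GRing.unit -> opfun x (opfun x^-1 u) = u.
Proof. by move=> ux; rewrite -opfun_mul mulrV. Qed.

Lemma opalg_normP x u : rnorm (opfun x u) <= opalg_norm x * rnorm u.
Proof. exact/opnormP/opalg_bounded. Qed.

Lemma opalg_norm_ge0 x : 0 <= opalg_norm x.
Proof. exact/opnorm_ge0/opalg_bounded. Qed.

Lemma opalg_banach : banach_norm opalg_norm.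
Proof.
split.
- move=> x y; apply: opnorm_le => [|u]; first by rewrite addr_ge0 ?opalg_norm_ge0.
  by rewrite (le_trans (rnormD _ _)) // mulrDl lerD ?opalg_normP.
- move=> x y; apply: opnorm_le => [|u]; first by rewrite mulr_ge0 ?opalg_norm_ge0.
  rewrite opfun_mul (le_trans (opalg_normP _ _)) // -mulrA ler_wpM2l ?opalg_norm_ge0 //.
  exact: opalg_normP.
- move=> k x; apply: opnorm_le => [|u].
    by rewrite mulr_ge0 ?opalg_norm_ge0 ?normc_ge0.
  by rewrite opfun_scale rnormZ -mulrA ler_wpM2l ?normc_ge0 ?opalg_normP.
- move=> x x0; apply: opalg_inj => u; rewrite -[RHS]/(0 *: u) scale0r.
  apply: rnorm_eq0; apply/eqP; rewrite eq_le rnorm_ge0 andbT.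
  by have := opalg_normP x u; rewrite x0 mul0r.
- by apply: opnorm_le => // u; rewrite mul1r.
- move=> f M rho hr hf; have /andP[r0 r1] := hr.
  have M0 : 0 <= M.
    by have := hf 0%N; rewrite expr0 mulr1; apply: le_trans; exact: opalg_norm_ge0.
  have s0 : 0 < 1 - rho by rewrite subr_gt0.
  have C0 n : 0 <= M / (1 - rho) * rho ^+ n.
    by rewrite mulr_ge0 ?exprn_ge0 // divr_ge0 // ltW.
  (* The limit is built pointwise in [H], shown to be linear and bounded, and placed in [A] by
     [uoa_closed]. *)
  have /choice[l hl] : forall u, exists l, forall n,
      rnorm (opfun (f n) u - l) <= M * rnorm u / (1 - rho) * rho ^+ n.
    move=> u; apply: geometric_limit => // n; rewrite -opfun_sub.
    rewrite (le_trans (opalg_normP _ _)) // mulrAC ler_wpM2r ?rnorm_ge0 //.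
  have hl' u n : rnorm (l u - opfun (f n) u) <= M / (1 - rho) * rho ^+ n * rnorm u.
    by rewrite -rnormN opprB (le_trans (hl _ _)) //; lra.
  have bl : bounded_operator l.
    split.
      move=> k u v; apply/eqP; rewrite -subr_eq0; apply/eqP/rnorm_eq0/eqP.
      rewrite eq_le rnorm_ge0 andbT.
      pose K := M / (1 - rho) * (rnorm (k *: u + v) + rnorm (k *: u) + rnorm v).
      apply: (geometric_le0 (K := K) hr) => n.
      have -> : l (k *: u + v) - (k *: l u + l v) =
          (l (k *: u + v) - opfun (f n) (k *: u + v)) -
          (k *: (l u - opfun (f n) u) + (l v - opfun (f n) v)).
        rewrite (opD _ _ (opalg_bounded (f n))) (opZ _ _ (opalg_bounded (f n))).
        by rewrite scalerBr [_ - _ + (_ - _)]addrACA -opprD opprB addrA subrK.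
      rewrite (le_trans (rnormB _ _)) //.
      have := rnormD (k *: (l u - opfun (f n) u)) (l v - opfun (f n) v).
      rewrite rnormZ; have := ler_wpM2l (normc_ge0 k) (hl' u n).
      have := hl' v n; have := hl' (k *: u + v) n; rewrite /K rnormZ; lra.
    exists (M / (1 - rho) + opalg_norm (f 0%N)) => u.
    have := hl' u 0%N; rewrite expr0 mulr1 => h.
    rewrite -(subrK (opfun (f 0%N) u) (l u)) (le_trans (rnormD _ _)) // mulrDl.
    by rewrite lerD ?opalg_normP.
  have hlf n : opnorm (l - opfun (f n)) <= M / (1 - rho) * rho ^+ n.
    by apply: opnorm_le => // u; exact: hl'.
  have Al : A l.
    apply: (uoa_closed hA bl) => e e0.
    have c0 := C0 0%N; rewrite expr0 mulr1 in c0.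
    have c1 : 0 < M / (1 - rho) + 1 by rewrite ltr_wpDl.
    have [n hn] : exists n, rho ^+ n < e / (M / (1 - rho) + 1).
      by apply: expr_small => //; rewrite divr_gt0.
    exists (opfun (f n)); first exact: opfunP.
    apply: le_lt_trans (hlf n) _.
    have {}hn : rho ^+ n * (M / (1 - rho) + 1) < e by rewrite -ltr_pdivlMr.
    by apply: le_lt_trans hn; rewrite mulrC ler_wpM2l ?exprn_ge0 // lerDl.
  exists (Opalg Al : E) => n; apply: opnorm_le => // u; rewrite opfun_sub /=.
  by rewrite -rnormN opprB hl'.
Qed.

Context (dot : {dot H for Num.conj}) (dotE : forall u : H, dot u u = `|u| ^+ 2).

Definition opacc (d : R) x := forall u, d * rnorm u ^+ 2 <= rdot dot (opfun x u) u.

(** [|u - t x u|^2 <= (1 - 2 t d + t^2 m) |u|^2], minimal at [t = d / m] with factor [1 - d^2 / m].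
    The [d ^+ 2] inside [m] keeps [m] positive and the factor nonnegative. *)
Lemma opacc_shrink d x : 0 < d -> opacc d x ->
  exists2 t, 0 < t & opalg_norm (1 - t%:C *: x) < 1.
Proof.
move=> d0 hx; pose m := opalg_norm x ^+ 2 + d ^+ 2.
have d20 : 0 < d ^+ 2 by rewrite exprn_gt0.
have m0 : 0 < m by rewrite ltr_wpDl ?sqr_ge0.
have tm : d ^+ 2 / m <= 1 by rewrite ler_pdivrMr // mul1r lerDr sqr_ge0.
exists (d / m); first by rewrite divr_gt0.
have s0 : 0 <= 1 - d ^+ 2 / m by rewrite subr_ge0.
apply: (@le_lt_trans _ _ (Num.sqrt (1 - d ^+ 2 / m))); last first.
  by rewrite -[ltRHS]sqrtr1 ltr_sqrt // gtrBl divr_gt0.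
apply: opnorm_le => [|u]; first exact: sqrtr_ge0.
rewrite -(@ler_pXn2r _ 2) ?nnegrE ?mulr_ge0 ?rnorm_ge0 ?sqrtr_ge0 //.
rewrite exprMn sqr_sqrtr // opfun_sub (rnorm_sqrBZ dotE).
rewrite rdotC.
have h1 : 2 * (d / m) * (d * rnorm u ^+ 2) <= 2 * (d / m) * rdot dot (opfun x u) u.
  by apply: ler_wpM2l (hx u); rewrite mulr_ge0 // divr_ge0 // ltW.
have h2 : (d / m) ^+ 2 * rnorm (opfun x u) ^+ 2 <= (d ^+ 2 / m) * rnorm u ^+ 2.
  apply: (@le_trans _ _ ((d / m) ^+ 2 * (m * rnorm u ^+ 2))).
    rewrite ler_wpM2l ?sqr_ge0 // (@le_trans _ _ ((opalg_norm x * rnorm u) ^+ 2)) //.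
      by rewrite ler_pXn2r ?nnegrE ?mulr_ge0 ?rnorm_ge0 ?opalg_norm_ge0 ?opalg_normP.
    by rewrite exprMn ler_wpM2r ?sqr_ge0 // lerDl ltW.
  by rewrite le_eqVlt; apply/orP; left; apply/eqP; field; rewrite gt_eqF.
rewrite opfun_one; move: h1 h2; set A1 := rnorm u; set A2 := rnorm _.
have -> : 2 * (d / m) * (d * A1 ^+ 2) = 2 * (d ^+ 2 / m) * A1 ^+ 2.
  by field; rewrite gt_eqF.
lra.
Qed.

Lemma opacc_unit d x : 0 < d -> opacc d x -> x \is a GRing.unit.
Proof.
move=> d0 hx; have [t t0 ht] := opacc_shrink d0 hx.
have := neumann opalg_banach ht; rewrite opprB addrC subrK scaler_unit //.
by rewrite unitfE; apply/eqP => /complexI/eqP; rewrite gt_eqF.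
Qed.

(** Follows from [|x u - d u|^2 >= 0]. *)
Lemma opacc_lower d x u : 0 <= d -> opacc d x -> d * rnorm u <= rnorm (opfun x u).
Proof.
move=> d0 hx; rewrite -(@ler_pXn2r _ 2) ?nnegrE ?mulr_ge0 ?rnorm_ge0 //.
have := sqr_ge0 (rnorm (opfun x u - d%:C *: u)); rewrite (rnorm_sqrBZ dotE) exprMn.
have := ler_wpM2l d0 (hx u); lra.
Qed.

Lemma opacc_accretivity : accretivity (N := opalg_norm) opacc.
Proof.
have inv d x : 0 < d -> opacc d x -> exists2 e, 0 < e & opacc e x^-1.
  move=> d0 hx; have ux := opacc_unit d0 hx.
  pose m := opalg_norm x + 1; have m0 : 0 < m by rewrite ltr_wpDl ?opalg_norm_ge0.
  (* For [v = x^-1 u], [Re <x v, v> >= d |v|^2] and [|u| <= m |v|]. *)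
  exists (d / m ^+ 2) => [|u]; first by rewrite divr_gt0 ?exprn_gt0.
  set v := opfun x^-1 u; have hv := hx v; have nv := opalg_normP x v.
  rewrite opfunK // in hv nv; rewrite rdotC.
  apply: le_trans hv; rewrite -mulrA ler_wpM2l ?(ltW d0) //.
  rewrite ler_pdivrMl ?exprn_gt0 // -exprMn.
  rewrite ler_pXn2r ?nnegrE ?mulr_ge0 ?rnorm_ge0 ?(ltW m0) //.
  by rewrite (le_trans nv) // ler_wpM2r ?rnorm_ge0 // lerDl.
split=> //.
- by move=> u; rewrite mul1r opfun_one (rdot_norm dotE).
- by move=> d e x ed hx u; apply: le_trans (hx u); rewrite ler_wpM2r ?sqr_ge0.
- by move=> d e x y hx hy u; rewrite opfun_add rdotDl mulrDl lerD.
- by move=> d t x t0 hx u; rewrite opfun_scale rdotZl -mulrA ler_wpM2l.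
- exact: opacc_unit.
- move=> d x d0 hx; have ux := opacc_unit d0 hx.
  apply: opnorm_le => [|u]; first by rewrite invr_ge0 ltW.
  have := opacc_lower (opfun x^-1 u) (ltW d0) hx; rewrite opfunK // => h.
  by rewrite ler_pdivlMl.
- move=> d x y d0 hx hy u.
  have [e1 e10 h1] := inv _ _ d0 hx; have [e2 e20 h2] := inv _ _ d0 hy.
  have us : x^-1 + y^-1 \is a GRing.unit.
    apply: (opacc_unit (d := e1 + e2)); first exact: addr_gt0.
    by move=> v; rewrite opfun_add rdotDl mulrDl lerD.
  (* With [p = x^-1 w] and [q = y^-1 w], [p + q = 2 u], so [2 Re <w, u> >= d (|p|^2 + |q|^2) >= 2 d
     |u|^2]. *)
  set h := 2 *: _; set w := opfun h u.
  have e : opfun x^-1 w + opfun y^-1 w = 2%:C *: u.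
    rewrite -opfun_add /w -opfun_mul /h -scalerAr mulrV // opfun_scale opfun_one.
    by rewrite rmorph_nat.
  have ux := opacc_unit d0 hx; have uy := opacc_unit d0 hy.
  have := hx (opfun x^-1 w); have := hy (opfun y^-1 w).
  rewrite !opfunK //; set p := opfun x^-1 w in e *; set q := opfun y^-1 w in e *.
  move=> hq hp.
  have e3 : 2 * rdot dot w u = rdot dot w p + rdot dot w q.
    by rewrite -rdotDr e rdotZr.
  have e4 : 4 * rnorm u ^+ 2 <= 2 * (rnorm p ^+ 2 + rnorm q ^+ 2).
    have -> : 4 * rnorm u ^+ 2 = rnorm (p + q) ^+ 2.
      by rewrite e rnormZ normc_realC normr_nat exprMn -natrX.
    have := sqr_ge0 (rnorm (p - q)).
    have := rnorm_sqrBZ dotE 1 p q; rewrite rmorph1 scale1r => ->.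
    by rewrite (rnorm_sqrD dotE); lra.
  have := ler_wpM2l (ltW d0) e4; lra.
- move=> d f l K rho hr hd hK u.
  rewrite -subr_le0; apply: (geometric_le0 (K := K * rnorm u ^+ 2) hr) => n.
  have h1 := hd n u.
  have h2 : rdot dot (opfun (f n - l) u) u <= K * rho ^+ n * rnorm u ^+ 2.
    apply: le_trans (rdot_cauchy_schwarz dotE _ _) _.
    rewrite [_ ^+ 2]expr2 mulrA ler_wpM2r ?rnorm_ge0 //.
    by rewrite (le_trans (opalg_normP _ _)) // ler_wpM2r ?rnorm_ge0.
  have : rdot dot (opfun (f n) u) u =
      rdot dot (opfun l u) u + rdot dot (opfun (f n - l) u) u.
    by rewrite -rdotDl opfun_sub addrC subrK.
  by move=> e; rewrite e in h1; lra.
Qed.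

End OperatorAlgebra.

(** * Numerical range *)

Section Ultralimit.
Local Open Scope complex_scope.
Context {R : realType} {T : Type} {U : set_system T} {UU : UltraFilter U}.

Lemma fmap_ultra (S : Type) (f : T -> S) : UltraFilter (f @ U).
Proof.
apply: Build_UltraFilter => G GG fG; apply/seteqP; split=> // A GA.
have [//|nA] := in_ultra_setVsetC (f @^-1` A) UU.
have GnA : G (~` A) by apply: fG.
by exfalso; apply: (filter_not_empty G); rewrite -(setICr A); exact: filterI.
Qed.

(** The image of [U] is an ultrafilter containing a compact segment. *)
Lemma ultra_bounded_cvg (r : T -> R) (M : R) : (forall n, `|r n| <= M) ->
  r @ U --> lim (r @ U).
Proof.
move=> rM; have := @segment_compact R (- M) M; rewrite compact_ultra.
move=> /(_ _ (fmap_ultra r))[|l [_ hl]]; last by apply/cvg_ex; exists l.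
rewrite /fmap /=; apply: filterE => n /=.
by rewrite in_itv /= -ler_norml rM.
Qed.

End Ultralimit.

(** * States, and strict accretivity as a uniform lower bound *)

Section NumericalRange.
Local Open Scope complex_scope.
Context {R : realType} {H : completeNormedModType R[i]}.
Context {dot : {dot H for Num.conj}} (dotE : forall u : H, dot u u = `|u| ^+ 2).
Context {A : set (H -> H)} (hA : unital_operator_algebra A).
Context (hH : exists u : H, u != 0).
Local Notation E := (opalg hA hH).
Implicit Types (x y : E) (u : H).

Section State.
Context {phi : (H -> H) -> R[i]} (hphi : states A phi).

Lemma state_linear k x y :
  phi (opfun (k *: x + y)) = k * phi (opfun x) + phi (opfun y).
Proof. by have [[lin _] _ _] := hphi; exact: lin (opfunP x) (opfunP y). Qed.

Lemma state0 : phi (opfun (0 : E)) = 0.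
Proof.
have := state_linear 1 0 0; rewrite scale1r addr0 mul1r => e.
by apply: (addrI (phi (opfun (0 : E)))); rewrite -e addr0.
Qed.

Lemma state_le x : normc (phi (opfun x)) <= opalg_norm x.
Proof.
have [[_ [M hM]] nrm _] := hphi.
have Re_norm (k : R[i]) : complex.Re `|k| = normc k by rewrite normr_normc.
have [x0|x0] := eqVneq (opalg_norm x) 0.
  by have := hM _ (opfunP x); rewrite [opnorm _]x0 mulr0 x0 Re_norm.
have nx : 0 < opalg_norm x by rewrite lt_neqAle eq_sym x0 opalg_norm_ge0.
pose y := (opalg_norm x)^-1%:C *: x.
have ny : opalg_norm y <= 1.
  rewrite (le_trans (bn_scale (opalg_banach hA hH) _ _)) // normc_realC.
  by rewrite ger0_norm ?invr_ge0 ?(ltW nx) // mulVf.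
have : normc (phi (opfun y)) <= 1.
  rewrite -nrm; apply: ub_le_sup; last first.
    by exists (opfun y); [split; [exact: opfunP|]|rewrite Re_norm].
  exists `|M| => _ [f [Af f1] <-]; apply: le_trans (hM f Af) _.
  apply: (@le_trans _ _ (`|M| * opnorm f)).
    by rewrite ler_wpM2r ?ler_norm // (opalg_norm_ge0 (hA := hA) (hH := hH) (Opalg Af)).
  by rewrite -[leRHS]mulr1 ler_wpM2l.
have -> : phi (opfun y) = (opalg_norm x)^-1%:C * phi (opfun x).
  by rewrite -[y]addr0 state_linear state0 addr0.
rewrite normcM normc_realC ger0_norm ?invr_ge0 ?(ltW nx) //.
by rewrite ler_pdivrMl // mulr1.
Qed.

End State.

(** A state has [|phi (1 - t x)| <= N (1 - t x) < 1] and [phi 1 = 1], hence [t Re phi(x) > 0]. *)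
Lemma strictly_acc_accretive x :
  strictly_acc (acc := opacc dot) x -> strictly_accretive A (opfun x).
Proof.
move=> [d d0 hx]; split; first exact: opfunP.
move=> _ [phi hphi <-]; have [t t0 ht] := opacc_shrink dotE d0 hx.
have [_ _ phi1] := hphi.
have := le_lt_trans (state_le hphi _) ht.
rewrite addrC -scaleN1r scalerA mulN1r (state_linear hphi) phi1 => h.
have := le_lt_trans (ler_norm _) (le_lt_trans (Re_le_normc _) h).
rewrite /right_half_plane /=; case: (phi (opfun x)) => c e /= h2.
rewrite -(pmulr_rgt0 _ t0); lra.
Qed.

Section VectorState.
Context {U : set_system nat} {UU : UltraFilter U} {e : nat -> H}.
Hypothesis e1 : forall n, rnorm (e n) = 1.

Let val (f : H -> H) n : R[i] := dot (f (e n)) (e n).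

(** An ultralimit of vector states, taken on real and imaginary parts separately so that compactness
    of real segments applies. *)
Definition vector_state (f : H -> H) : R[i] :=
  (lim ((fun n => complex.Re (val f n)) @ U) +i*
   lim ((fun n => complex.Im (val f n)) @ U))%C.

Let val_le f n : bounded_operator f -> normc (val f n) <= opnorm f.
Proof.
move=> bf; apply: le_trans (cauchy_schwarz dotE _ _) _; rewrite e1 mulr1.
by have := opnormP (e n) bf; rewrite e1 mulr1.
Qed.

Let cvg_Re f : bounded_operator f ->
  (fun n => complex.Re (val f n)) @ U --> complex.Re (vector_state f).
Proof.
move=> bf; apply: (@ultra_bounded_cvg _ _ U _ _ (opnorm f)) => n.
by rewrite (le_trans (Re_le_normc _)) // val_le.
Qed.

Let cvg_Im f : bounded_operator f ->
  (fun n => complex.Im (val f n)) @ U --> complex.Im (vector_state f).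
Proof.
move=> bf; apply: (@ultra_bounded_cvg _ _ U _ _ (opnorm f)) => n.
by rewrite (le_trans (Im_le_normc _)) // val_le.
Qed.

Let vector_stateE f (c d : R) :
  (fun n => complex.Re (val f n)) @ U --> c ->
  (fun n => complex.Im (val f n)) @ U --> d -> vector_state f = (c +i* d)%C.
Proof. by move=> /cvg_lim h1 /cvg_lim h2; rewrite /vector_state h1 // h2. Qed.

Lemma vector_state_le f : bounded_operator f -> normc (vector_state f) <= opnorm f.
Proof.
move=> bf; have M0 := opnorm_ge0 bf.
rewrite -(@ler_pXn2r _ 2) ?nnegrE ?normc_ge0 // normc_sqrE.
have c : (fun n => complex.Re (val f n) * complex.Re (val f n) +
      complex.Im (val f n) * complex.Im (val f n)) @ U -->
    complex.Re (vector_state f) * complex.Re (vector_state f) +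
      complex.Im (vector_state f) * complex.Im (vector_state f).
  by apply: cvgD; [apply: cvgM; exact: cvg_Re|apply: cvgM; exact: cvg_Im].
apply: (cvgr_to_le c); apply: filterE => n.
by rewrite -!expr2 -normc_sqrE ler_pXn2r ?nnegrE ?normc_ge0 // val_le.
Qed.

Lemma vector_state_one : vector_state idfun = 1.
Proof.
have h n : val idfun n = 1 by rewrite /val /= dotE rnormE e1 expr1n.
by apply: vector_stateE; (under eq_fun do rewrite h); exact: cvg_cst.
Qed.

Lemma vector_state_states : states A vector_state.
Proof.
have Re_norm (k : R[i]) : complex.Re `|k| = normc k by rewrite normr_normc.
split.
- split=> [k f g Af Ag|]; last first.
    exists 1 => f Af; rewrite Re_norm mul1r.
    by apply: vector_state_le; exact: (uoa_bounded hA).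
  have bf := uoa_bounded hA Af; have bg := uoa_bounded hA Ag.
  have hv n : val (k *: f + g) n = k * val f n + val g n.
    by rewrite /val linearDl linearZl_LR.
  rewrite (@vector_stateE _
    (complex.Re k * complex.Re (vector_state f) - complex.Im k * complex.Im (vector_state f)
      + complex.Re (vector_state g))
    (complex.Re k * complex.Im (vector_state f) + complex.Im k * complex.Re (vector_state f)
      + complex.Im (vector_state g))).
  + by case: k (vector_state f) (vector_state g) {hv} => a b [c d] [? ?].
  + rewrite (_ : (fun n => _) = (fun n => complex.Re k * complex.Re (val f n)
        - complex.Im k * complex.Im (val f n) + complex.Re (val g n))).
      apply: cvgD (cvg_Re bg); apply: cvgB; apply: cvgM; try exact: cvg_cst.
      * exact: cvg_Re.
      * exact: cvg_Im.
    by apply/funext => n; rewrite hv; case: k (val f n) (val g n) {hv} => a b [c d] [? ?].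
  + rewrite (_ : (fun n => _) = (fun n => complex.Re k * complex.Im (val f n)
        + complex.Im k * complex.Re (val f n) + complex.Im (val g n))).
      apply: cvgD (cvg_Im bg); apply: cvgD; apply: cvgM; try exact: cvg_cst.
      * exact: cvg_Im.
      * exact: cvg_Re.
    by apply/funext => n; rewrite hv; case: k (val f n) (val g n) {hv} => a b [c d] [? ?].
- have S1 : [set complex.Re `|vector_state f| | f in [set f | A f /\ opnorm f <= 1]] 1.
    exists idfun; last by rewrite vector_state_one Re_norm normc1.
    by split; [exact: (uoa_one hA)|apply: opnorm_le => // u; rewrite mul1r].
  apply/eqP; rewrite eq_le; apply/andP; split.
    apply: ge_sup; first by exists 1.
    move=> _ [f [Af f1] <-]; rewrite Re_norm (le_trans _ f1) //.
    by apply: vector_state_le; exact: (uoa_bounded hA).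
  apply: ub_le_sup => //; exists 1 => _ [f [Af f1] <-].
  rewrite Re_norm (le_trans _ f1) //.
  by apply: vector_state_le; exact: (uoa_bounded hA).
- exact: vector_state_one.
Qed.

Lemma vector_state_Re_le f (r : nat -> R) (c : R) : bounded_operator f ->
  r @ U --> c -> (forall n, complex.Re (val f n) <= r n) ->
  complex.Re (vector_state f) <= c.
Proof.
move=> bf rc h; rewrite -subr_le0.
have d : (fun n => complex.Re (val f n) - r n) @ U --> complex.Re (vector_state f) - c.
  by apply: cvgB => //; exact: cvg_Re.
apply: (cvgr_to_le d).
by apply: filterE => n /=; rewrite subr_le0.
Qed.

End VectorState.

(* Failure of a uniform lower bound yields unit vectors along which
   [Re <x e_n, e_n>] tends to a nonpositive value; an ultralimit of the
   corresponding vector states is then a state with [Re phi(x) <= 0]. *)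
Lemma accretive_strictly_acc x :
  strictly_accretive A (opfun x) -> strictly_acc (acc := opacc dot) x.
Proof.
move=> [_ hW]; apply: contrapT => nacc.
have /choice[e he] : forall n, exists u : H, rnorm u = 1 /\
    rdot dot (opfun x u) u <= n.+1%:R^-1.
  move=> n; apply: contrapT => hn; apply: nacc.
  exists n.+1%:R^-1 => [|u]; first by rewrite invr_gt0.
  have [->|u0] := eqVneq u 0.
    by rewrite rnorm0 expr0n mulr0 /rdot linear0r.
  have nu : 0 < rnorm u.
    by rewrite lt_neqAle rnorm_ge0 eq_sym andbT; apply: contra u0 => /eqP/rnorm_eq0 ->.
  rewrite leNgt; apply/negP => hlt; apply: hn.
  exists ((rnorm u)^-1%:C *: u); split.
    by rewrite rnormZ normc_realC ger0_norm ?invr_ge0 ?(ltW nu) // mulVf ?gt_eqF.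
  rewrite (opZ _ _ (opalg_bounded x)) rdotZl rdotZr mulrA -expr2 exprVn.
  by rewrite ler_pdivrMl ?exprn_gt0 // mulrC ltW.
have [U [UU hU]] := ultraFilterLemma eventually_filter.
have st := vector_state_states (UU := UU) (fun n => (he n).1).
have := hW _ (ex_intro2 _ _ _ st erefl).
rewrite /right_half_plane /= ltNge => /negP; apply.
apply: (vector_state_Re_le (fun n => (he n).1) (r := fun n => n.+1%:R^-1)).
- exact: opalg_bounded.
- apply: cvg_trans (@cvg_harmonic R); exact: cvg_app.
- by move=> n; exact: (he n).2.
Qed.

End NumericalRange.

(** * The geometric mean *)

Section Translation.
Local Open Scope complex_scope.
Context {R : realType} {H : completeNormedModType R[i]}.
Context {A : set (H -> H)} {hA : unital_operator_algebra A}.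
Context {hH : exists u : H, u != 0}.
Local Notation E := (opalg hA hH).
Implicit Types (x y r : E).

Lemma is_inverseE x y : x * y = 1 -> y * x = 1 -> is_inverse A (opfun x) (opfun y).
Proof.
move=> xy yx; split; first exact: opfunP.
- by rewrite -[idfun]/(opfun (1 : E)) -xy.
- by rewrite -[idfun]/(opfun (1 : E)) -yx.
Qed.

Lemma is_inverse_opfun x (g : H -> H) : is_inverse A (opfun x) g ->
  x \is a GRing.unit /\ g = opfun x^-1.
Proof.
move=> [Ag xg gx]; pose y : E := Opalg Ag.
have xy : x * y = 1 by apply: opalg_inj => u; exact: (congr1 (fun f => f u) xg).
have yx : y * x = 1 by apply: opalg_inj => u; exact: (congr1 (fun f => f u) gx).
have ux : x \is a GRing.unit by apply/unitrP; exists y.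
by split=> //; rewrite -[g]/(opfun y) -[y]mul1r -(mulVr ux) -mulrA xy mulr1.
Qed.

Lemma opinvE x : x \is a GRing.unit -> opinv A (opfun x) = opfun x^-1.
Proof.
move=> ux; rewrite /opinv; case: xgetP => [g _ /is_inverse_opfun[]//|].
by move=> /(_ (opfun x^-1)); case; apply: is_inverseE; rewrite ?mulrV ?mulVr.
Qed.

Lemma spectrumE x l : spectrum A (opfun x) l <-> l%:A - x \isn't a GRing.unit.
Proof.
rewrite /spectrum /=.
have -> : l *: idfun - opfun x = opfun (l%:A - x).
  by apply/funext => u; rewrite opfun_sub.
split=> [h|/negP h [g /is_inverse_opfun[//]]].
apply/negP => ux; apply: h; exists (opfun (l%:A - x)^-1).
by apply: is_inverseE; rewrite ?mulrV ?mulVr.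
Qed.

Lemma principal_sqrtE x r : is_principal_sqrt A (opfun x) (opfun r) <-> is_sqrt x r.
Proof.
split=> [[_ rx sp]|[rx sp]].
- split=> [|l l0]; first by apply: opalg_inj => u; exact: (congr1 (fun f => f u) rx).
  apply: contraT => /spectrumE/sp; rewrite /right_half_plane /= => l1.
  by move: l1 l0; rewrite ltNge => /negP.
- split; [exact: opfunP|by rewrite -rx|move=> l /spectrumE nu].
  by rewrite /right_half_plane /= ltNge; apply: contra nu => /sp.
Qed.

(** Uniqueness of principal square roots excludes the default value of [opsqrt]. *)
Lemma opsqrtE x r : is_sqrt x r -> opsqrt A (opfun x) = opfun r.
Proof.
move=> hr; have uniq_sqrt g : is_principal_sqrt A (opfun x) g -> opfun r = g.
  move=> hg; have [Ag _ _] := hg; rewrite -[g]/(opfun (Opalg Ag : E)); congr opfun.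
  apply: (is_sqrt_unique (opalg_banach hA hH) hr); exact/principal_sqrtE.
rewrite /opsqrt; case: xgetP => [g _ [/uniq_sqrt //]|/(_ (opfun r))[]].
by split=> //; exact/principal_sqrtE.
Qed.

End Translation.

Theorem theorem5p1 (R : realType) (H : completeNormedModType R[i])
    (dot : {dot H for Num.conj})
    (dotE : forall u : H, dot u u = `|u| ^+ 2)
    (A : set (H -> H)) (hA : unital_operator_algebra A)
    (a b : H -> H)
    (ha : strictly_accretive A a) (hb : strictly_accretive A b) :
  [/\ spectrum A (sandwich A a b) `&` nonpos_reals = set0,
      spectrum A (sandwich A b a) `&` nonpos_reals = set0 &
      let G := gmean A a b in
      [/\ strictly_accretive A G,
          G \o opinv A a \o G = b,
          (forall x : H -> H, strictly_accretive A x ->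
             x \o opinv A a \o x = b -> x = G) &
          G = gmean A b a]].
Proof.
(* On the zero space all maps coincide, so [idfun] inverts every operator and spectra are empty.
   Otherwise [opalg] is a nontrivial ring. *)
have [hH|hH] := pselect (exists u : H, u != 0); last first.
  have H0 (u v : H) : u = v.
    have E0 w : w = 0 :> H by apply: contrapT => /eqP w0; apply: hH; exists w.
    by rewrite (E0 u) (E0 v).
  have fE (f g : H -> H) : f = g by apply/funext.
  have sp0 f : spectrum A f `&` nonpos_reals = set0.
    rewrite -subset0 => l [+ _]; apply; exists idfun.
    by split; [exact: (uoa_one hA)|exact: fE|exact: fE].
  split; [exact: sp0|exact: sp0|split=> //].
  by rewrite (fE (gmean A a b) a).
pose x : opalg hA hH := Opalg ha.1; pose y : opalg hA hH := Opalg hb.1.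
have acc := opacc_accretivity hA hH dotE; have bN := opalg_banach hA hH.
have sx : strictly_acc (acc := opacc dot) x by exact: accretive_strictly_acc.
have sy : strictly_acc (acc := opacc dot) y by exact: accretive_strictly_acc.
have ux := strictly_acc_unit acc sx.
have [r hr] := strictly_acc_sqrt bN acc sx; have [s hs] := strictly_acc_sqrt bN acc sy.
have [G [sG eG uG Gx Gy]] := geometric_mean_formula bN acc sx sy.
have sandwichE (z w p : opalg hA hH) : is_sqrt z p ->
    sandwich A (opfun z) (opfun w) = opfun (p^-1 * w * p^-1).
  by move=> hp; rewrite /sandwich (opsqrtE hp) opinvE // (is_sqrt_unit hp).
have gmeanE (z w p q : opalg hA hH) : is_sqrt z p -> is_sqrt (p^-1 * w * p^-1) q ->
    gmean A (opfun z) (opfun w) = opfun (p * q * p).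
  by move=> hp hq; rewrite /gmean (sandwichE _ _ _ hp) (opsqrtE hp) (opsqrtE hq).
have sp (z w p : opalg hA hH) : strictly_acc (acc := opacc dot) z ->
    strictly_acc (acc := opacc dot) w -> is_sqrt z p ->
    spectrum A (sandwich A (opfun z) (opfun w)) `&` nonpos_reals = set0.
  move=> sz sw hp; rewrite (sandwichE _ _ _ hp) -subset0 => l [/spectrumE /negP].
  (* Here [l = - t] with [t = - Re l >= 0], the case covered by [sandwich_unit]. *)
  move=> nl [l0 l1]; apply: nl; have t0 : 0 <= - complex.Re l by rewrite oppr_ge0.
  have := sandwich_unit acc sz sw hp t0; rewrite rmorphN opprK.
  by congr (_%:A - _ \is a GRing.unit); case: l l1 {l0 t0} => c d /= ->.
have Ga : gmean A a b = opfun G.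
  by have [q hq <-] := Gx r hr; exact: (gmeanE x y).
have Gb : gmean A b a = opfun G.
  by have [q hq <-] := Gy s hs; exact: (gmeanE y x).
split; [exact: (sp x y r)|exact: (sp y x s)|rewrite /= Ga Gb].
have -> : opinv A a = opfun x^-1 by exact: (opinvE ux).
split=> //.
- exact: strictly_acc_accretive.
- by rewrite -[RHS]/(opfun y) -eG.
- move=> f hf ef; pose z : opalg hA hH := Opalg hf.1.
  suff -> : G = z by [].
  apply/esym/uG; first exact: accretive_strictly_acc.
  by apply: opalg_inj => u; exact: (congr1 (fun g => g u) ef).
Qed.
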